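(* For $3\le n\le 6$, every perfect bitrade in the Star graph $S_n$ is embeddable. For $n\in\{3,4,5\}$ the volume of every perfect bitrade in $S_n$ equals $(n-1)!$. For $n=6$ the set of volumes of perfect bitrades in $S_6$ is $\{120,100,96\}$.
   Context: $\mathrm{Sym}_n$ is the symmetric group on $\{1,\ldots,n\}$. For a group $G$ with an inverse-closed generating set $H$ not containing the identity, the Cayley graph $\Gamma(G,H)$ has vertex set $G$ and edge set $\{(hg,g): g\in G,\ h\in H\}$. The Star graph is $S_n=\Gamma(\mathrm{Sym}_n,\{(1\ i):2\le i\le n\})$; it is $(n-1)$-regular. A code in a graph is a subset $C$ of its vertices; its minimum distance is $\min_{x,y\in C,\,x\ne y}d(x,y)$, where $d$ is the graph distance. A code $C$ in a $k$-regular graph with vertex set $V$ is perfect if its minimum distance is $3$ and $|C|=|V|/(k+1)$. Let $T_0,T_1$ be distinct, disjoint subsets of vertices of a graph $\Gamma$ (so they are not both empty). The ordered pair $(T_0,T_1)$ is a perfect bitrade if for every vertex $x$ the set consisting of $x$ and its neighbors in $\Gamma$ meets $T_0$ and $T_1$ in the same number of vertices, and this number is zero or one. The volume of the bitrade is $|T_0|$. A perfect bitrade is embeddable (into a perfect code) if it is of the form $(C\setminus C',C'\setminus C)$ for some perfect codes $C,C'$ in $\Gamma$. *)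

(* Defs.v *)
From mathcomp Require Import all_boot all_fingroup.

Set Implicit Arguments.
Unset Strict Implicit.
Unset Printing Implicit Defensive.

(* A graph is given by its adjacency relation [e] on a finite vertex type. *)
Section Graphs.
Variables (T : finType) (e : rel T).

Definition closed_nbhd (x : T) : {set T} := [set y | (y == x) || e x y].

Definition regular (k : nat) : Prop := forall x : T, #|[set y | e x y]| = k.

Definition walk (x y : T) (d : nat) : Prop :=
  exists p : seq T, [/\ path e x p, last x p = y & size p = d].

(* No [d] satisfies this when [x] and [y] lie in different components, which
   stands for an infinite distance. *)
Definition is_distance (x y : T) (d : nat) : Prop :=
  walk x y d /\ forall d' : nat, walk x y d' -> d <= d'.

Definition is_min_distance (C : {set T}) (d : nat) : Prop :=
  (exists x y : T, [/\ x \in C, y \in C, x != y & is_distance x y d]) /\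
  (forall (x y : T) (d' : nat),
     x \in C -> y \in C -> x != y -> is_distance x y d' -> d <= d').

(* The cardinality condition |C| = |V| / (k + 1) is an exact quotient, hence
   multiplied out rather than written with the truncated division of [nat]. *)
Definition perfect_code (C : {set T}) : Prop :=
  exists k : nat,
    [/\ regular k, is_min_distance C 3 & #|C| * k.+1 = #|T|].

Definition perfect_bitrade (T0 T1 : {set T}) : Prop :=
  [/\ T0 != T1, [disjoint T0 & T1] &
      forall x : T, #|closed_nbhd x :&: T0| = #|closed_nbhd x :&: T1| /\
                    #|closed_nbhd x :&: T0| <= 1].

Definition embeddable (T0 T1 : {set T}) : Prop :=
  exists C C' : {set T},
    [/\ perfect_code C, perfect_code C', T0 = C :\: C' & T1 = C' :\: C].

End Graphs.

Definition cayley (gT : finGroupType) (H : {set gT}) : rel gT :=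
  fun x g => [exists h in H, x == (h * g)%g].

(* Sym_n acts on 'I_n = {0, .., n-1}, so the point 1 becomes 0.  Permutations
   are multiplied left factor first; the opposite convention gives an isomorphic
   graph, via inversion, with the edges given by right multiplication. *)
Definition star_transpositions (n : nat) : {set 'S_n} :=
  [set tperm i j | i in [set i : 'I_n | val i == 0],
                   j in [set j : 'I_n | val j != 0]].

Definition star_graph (n : nat) : rel 'S_n := cayley (star_transpositions n).

(* Main.v *)
(* To a bitrade (T0, T1) attach f = 1_T0 - 1_T1. It sums to 0 over every ball, so
   it lies in the eigenspace of the Star graph for the eigenvalue -1. For n <= 5
   that eigenspace consists of functions of w(0), and the claims follow. For n = 6
   it also contains the functions sum_i M(i, w.i), where w.i is the image of the
   i-th total under w (the outer automorphism of Sym_6): with s_a, S_ik the sums of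
   f over the codes C_a = {w : w(0) = a} and D_ik = {w : w.i = k},
     720 f(w) = 6 s_(w 0) + 5 sum_i S_(i, w.i).
   Differences of values of f show that 120 | s_a - s_b and that the second
   differences of S are divisible by 144, so f(w) = const + c(w 0) + sum_i N(i, w.i)
   with integral c and N. Multiplying the expansion by f(w) and summing bounds the
   quadratic form 10 q(c) + sum_(i,j) q(N_i - N_j) = |T0| + |T1| <= 240, where
   q(d) = sum_(k,l) (d_k - d_l)^2. Together with 0 = sum f modulo 6 this leaves
   only f = 1_X - 1_Y with X, Y among the 42 codes C_a, D_ik, and volumes
   120 - |X cap Y| with |X cap Y| = 0, 20 or 24. *)
Require Import Defs.
From mathcomp Require Import all_boot all_order all_fingroup all_algebra zify ring.

Set Implicit Arguments.
Unset Strict Implicit.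
Unset Printing Implicit Defensive.

Import Order.TTheory GRing.Theory Num.Theory.
Local Open Scope nat_scope.

(** * Exact codes and perfect codes in a general graph *)

Section ExactCodes.
Variables (T : finType) (e : rel T).
Implicit Types (x y z : T) (C : {set T}).

(** For symmetric [e] this says that the balls around the elements of [C] partition the vertices. *)
Definition exact_code C : Prop := forall x, #|closed_nbhd e x :&: C| = 1.

Lemma exact_code_uniq C x y z :
  exact_code C -> y \in closed_nbhd e x -> z \in closed_nbhd e x ->
  y \in C -> z \in C -> y = z.
Proof.
move=> exC yx zx yC zC; have /eqP/cards1P[t tE] := exC x.
have /set1P -> : y \in [set t] by rewrite -tE inE yx.
by apply/esym/set1P; rewrite -tE inE zx.
Qed.

(** Double counting of the pairs (x, y) with y in [C] and in the ball of x: by symmetry each y lies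
    in [k] balls. *)
Lemma sum_card_nbhd C k :
  symmetric e -> (forall x, #|closed_nbhd e x| = k) ->
  \sum_x #|closed_nbhd e x :&: C| = #|C| * k.
Proof.
move=> e_sym ek; under eq_bigr do rewrite -sum1_card big_mkcond /=.
rewrite exchange_big /= -sum_nat_const [RHS]big_mkcond /=; apply: eq_bigr => y _.
case: ifP => yC; last by rewrite big1 // => x _; rewrite inE yC andbF.
rewrite -(ek y) -sum1_card [RHS]big_mkcond /=; apply: eq_bigr => x _.
by rewrite !inE yC andbT [y == x]eq_sym e_sym.
Qed.

(** Discarding the common part of [C] and [C'] removes the same points from both traces on a
    ball. *)
Lemma exact_code_bitrade C C' :
  exact_code C -> exact_code C' -> C != C' ->
  perfect_bitrade e (C :\: C') (C' :\: C).
Proof.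
move=> exC exC' neqC; split=> [||x].
- apply: contraNN neqC => /eqP eqD; apply/eqP/setP=> x.
  by move/setP/(_ x): eqD; rewrite !inE; case: (x \in C); case: (x \in C').
- rewrite -setI_eq0; apply/eqP/setP=> x; rewrite !inE.
  by case: (x \in C); case: (x \in C').
have hC := cardsID C' (closed_nbhd e x :&: C).
have hC' := cardsID C (closed_nbhd e x :&: C').
move: hC hC'; rewrite exC exC' -!setIA [C' :&: C]setIC -!setIDA; lia.
Qed.

Hypotheses (e_sym : symmetric e) (e_irr : irreflexive e).

(** The ends of a walk of length 1 or 2 lie in one ball, around [x] or around the midpoint. *)
Lemma exact_code_walk C x y d :
  exact_code C -> x \in C -> y \in C -> x != y -> walk e x y d -> 3 <= d.
Proof.
move=> exC xC yC neqxy [p [ep lp <-]].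
have cn u v : e u v -> v \in closed_nbhd e u by move=> uv; rewrite inE uv orbT.
have cn0 u : u \in closed_nbhd e u by rewrite inE eqxx.
case: p ep lp => [|z [|t [|? ?]]] //=; first by move=> _ xy; rewrite xy eqxx in neqxy.
  rewrite andbT => xz zy; case/eqP: neqxy.
  by apply: (exact_code_uniq exC (cn0 x)) => //; apply: cn; rewrite -zy.
case/and3P=> xz zt _ ty; case/eqP: neqxy.
by apply: (@exact_code_uniq _ z) => //; apply: cn; rewrite ?(e_sym z x) // -ty.
Qed.

(** Distance 3 is attained between [x] in [C] and the codeword in the ball of a vertex [z] at
    distance 2 from [x]. *)
Lemma exact_code_perfect C k :
  regular e k ->
  (forall x, exists y z, [/\ e x y, e y z, z != x & ~~ e x z]) ->
  C != set0 -> exact_code C -> perfect_code e C.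
Proof.
move=> e_reg far /set0Pn[x xC] exC; exists k; split=> //; first split.
- have [y [z [xy yz neqzx nexz]]] := far x.
  have /eqP/cards1P[u uE] := exC z.
  have /setIP[uz uC] : u \in closed_nbhd e z :&: C by rewrite uE set11.
  have w2 : walk e x z 2 by exists [:: y; z]; rewrite /= xy yz.
  have zC : z \notin C.
    by apply/negP=> zC; have := exact_code_walk exC xC zC;
      rewrite eq_sym => /(_ _ neqzx w2).
  have ezu : e z u by move: uz; rewrite inE => /predU1P[uz|//]; rewrite -uz uC in zC.
  have neqxu : x != u by apply: contraNneq nexz => ->; rewrite e_sym.
  exists x, u; split=> //; split; first by exists [:: y; z; u]; rewrite /= xy yz ezu.
  by move=> d' /(exact_code_walk exC xC uC neqxu).
- by move=> y z d yC zC neqyz [/(exact_code_walk exC yC zC neqyz)].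
rewrite -(@sum_card_nbhd C k.+1) //; last first.
  move=> y; rewrite -(e_reg y) (_ : closed_nbhd e y = y |: [set z | e y z]).
    by rewrite cardsU1 inE e_irr.
  by apply/setP=> z; rewrite !inE.
by under eq_bigr do rewrite exC; rewrite sum1_card.
Qed.

End ExactCodes.

(** * Permutations in one-line notation, for finite checks by computation *)

Section Words.
Variable n : nat.
Implicit Types u v w : 'S_n.+1.

Definition word v : seq nat := [seq val (v i) | i <- enum 'I_n.+1].

Lemma size_word v : size (word v) = n.+1.
Proof. by rewrite size_map size_enum_ord. Qed.

Lemma nth_word v (i : 'I_n.+1) : nth 0%N (word v) i = v i.
Proof. by rewrite (nth_map i) ?size_enum_ord // nth_ord_enum. Qed.

Lemma word_inj : injective word.
Proof.
move=> u v uv; apply/permP => i; apply: val_inj.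
by rewrite /= -!nth_word uv.
Qed.

Lemma word_mem v : word v \in permutations (iota 0 n.+1).
Proof.
rewrite mem_permutations -val_enum_ord /word (map_comp val v) perm_map //.
apply: uniq_perm; rewrite ?(map_inj_uniq perm_inj) ?enum_uniq // => i.
by rewrite mem_enum; apply/mapP; exists (v^-1%g i); rewrite ?mem_enum ?permKV.
Qed.

Definition star (j : 'I_n.+1) : 'S_n.+1 := tperm ord0 j.

End Words.

Definition swap0 (w : seq nat) (j : nat) : seq nat :=
  set_nth 0%N (set_nth 0%N w 0 (nth 0%N w j)) j (nth 0%N w 0).

Lemma word_star n (j : 'I_n.+1) (v : 'S_n.+1) :
  word (star j * v)%g = swap0 (word v) j.
Proof.
have jn := ltn_ord j.
apply: (@eq_from_nth _ 0%N) => [|i]; rewrite size_word.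
  by rewrite /swap0 !size_set_nth size_word; lia.
move=> ltin; have [k ->] : exists k : 'I_n.+1, i = k by exists (Ordinal ltin).
rewrite nth_word /swap0 !nth_set_nth /= permM /star -nth_word.
case: tpermP => [->|->|/eqP + /eqP].
- by rewrite nth_set_nth /=; case: eqP => [<-|].
- by rewrite eqxx.
- by rewrite -!val_eqE nth_set_nth /= => /negPf -> /negPf ->.
Qed.

Lemma nth_word0 n (v : 'S_n.+1) : nth 0 (word v) 0 = v ord0.
Proof. exact: (nth_word v ord0). Qed.

Definition words (n : nat) : seq (seq nat) := permutations (iota 0 n).

Lemma word1 n : word (1%g : 'S_n.+1) = iota 0 n.+1.
Proof.
by rewrite -val_enum_ord; apply/eq_map => i; rewrite perm1.
Qed.

Lemma word_eq1 n (v : 'S_n.+1) : (word v == iota 0 n.+1) = (v == 1%g).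
Proof. by rewrite -word1 (inj_eq (@word_inj n)). Qed.

(** The term j = 0 is [y w] itself, so this is A + 1 applied to [y], with A the adjacency operator.
    The [foldr] evaluates under [vm_compute]. *)
Definition sum_star (n : nat) (y : seq nat -> int) (w : seq nat) : int :=
  foldr (fun j s => y (swap0 w j) + s)%R 0%R (iota 0 n).

Lemma sum_starE n y (v : 'S_n.+1) :
  sum_star n.+1 y (word v) = (\sum_j y (word (star j * v)%g))%R.
Proof.
under eq_bigr do rewrite word_star.
rewrite -(big_mkord xpredT (fun j => y (swap0 (word v) j))) /index_iota subn0.
by rewrite /sum_star unlock.
Qed.

(* Enough of the cycle type of w, with the cycle of 0 marked, to separate the
   classes under conjugation by the stabilizer of 0 (the first component is one
   less than the length of the cycle of 0). *)
Definition key (w : seq nat) : nat * nat * nat :=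
  let f := nth 0 w in let r := iota 0 (size w) in
  (find (eqn 0) (traject f (f 0) (size w)), count (fun i => eqn (f i) i) r,
   count (fun i => eqn (f (f i)) i) r).

(* Solutions y of linear systems [sum_star n y = K], with K = [value_defect d n]
   for n <= 5 and K = [outer_defect] for n = 6, found among the functions of
   [key]. *)
Definition preimage_coef (n : nat) (w : seq nat) : int :=
  match n, key w with
  | 3, (0, 1, 3) => 1%Z | 3, (0, 3, 3) => 1%Z | 3, (2, 0, 0) => (-1)%Z
  | 4, (0, 1, 1) => 1%Z | 4, (0, 4, 4) => 1%Z | 4, (1, 0, 4) => 2%Z
  | 4, (1, 2, 4) => 3%Z | 4, (2, 1, 1) => (-2)%Z | 4, (3, 0, 0) => (-1)%Z
  | 5, (0, 1, 1) => 1%Z | 5, (0, 1, 5) => (-7)%Z | 5, (0, 2, 2) => 2%Z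
  | 5, (0, 3, 5) => (-5)%Z | 5, (0, 5, 5) => 5%Z | 5, (1, 0, 2) => 1%Z
  | 5, (1, 1, 5) => 8%Z | 5, (1, 3, 5) => 16%Z | 5, (2, 0, 2) => 1%Z
  | 5, (2, 2, 2) => (-7)%Z | 5, (3, 1, 1) => (-2)%Z | 5, (4, 0, 0) => (-1)%Z
  | 6, (0, 1, 1) => (-1)%Z | 6, (0, 1, 3) => (-11)%Z | 6, (0, 2, 2) => 5%Z
  | 6, (0, 2, 6) => (-40)%Z | 6, (0, 3, 3) => 16%Z | 6, (0, 4, 6) => (-43)%Z
  | 6, (0, 6, 6) => 74%Z | 6, (1, 0, 2) => 3%Z | 6, (1, 0, 6) => 8%Z
  | 6, (1, 1, 3) => 4%Z | 6, (1, 2, 6) => 45%Z | 6, (1, 4, 6) => 122%Z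
  | 6, (2, 0, 0) => (-2)%Z | 6, (2, 1, 3) => 4%Z | 6, (2, 3, 3) => (-49)%Z
  | 6, (3, 0, 2) => 3%Z | 6, (3, 2, 2) => (-10)%Z | 6, (4, 1, 1) => (-6)%Z
  | 6, (5, 0, 0) => (-2)%Z
  | _, _ => 0%Z
  end.

Definition star_preimage (n : nat) (K : seq nat -> int) : bool :=
  all (fun w => sum_star n (preimage_coef n) w == K w) (words n).

(** * Balls and exact codes in the Star graph *)

Section StarGraph.
Variable n : nat.
Implicit Types (x v w : 'S_n.+1) (a : 'I_n.+1).
Local Notation E := (@star_graph n.+1).
Local Open Scope group_scope.

Lemma star0 : star ord0 = 1 :> 'S_n.+1. Proof. exact: tperm1. Qed.
Lemma starK (j : 'I_n.+1) x : star j * (star j * x) = x.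
Proof. by rewrite mulgA tperm2 mul1g. Qed.
Lemma star_inj x : injective (fun j => star j * x).
Proof. by move=> i j /mulIg/permP/(_ ord0); rewrite !tpermL. Qed.

Lemma star_graphP x y :
  reflect (exists2 j : 'I_n.+1, j != ord0 & y = star j * x) (E x y).
Proof.
apply: (iffP exists_inP) => [[h /imset2P[i j]]|[j j0 ->]].
  rewrite !inE => /eqP i0 j0 -> /eqP ->; exists j; first exact: j0.
  by have -> : i = ord0; [apply: val_inj | rewrite starK].
exists (star j); last by rewrite starK.
by apply/imset2P; exists ord0 j; rewrite ?inE.
Qed.

Lemma closed_nbhd_star x : closed_nbhd E x = [set star j * x | j : 'I_n.+1].
Proof.
apply/setP=> y; rewrite inE; apply/idP/imsetP.
  case/predU1P=> [->|/star_graphP[j _ ->]]; last by exists j.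
  by exists ord0; rewrite // star0 mul1g.
case=> j _ ->; have [->|j0] := eqVneq j ord0; first by rewrite star0 mul1g eqxx.
by apply/orP; right; apply/star_graphP; exists j.
Qed.

(** The index 0 accounts for [x] itself, since [star ord0] is the identity. *)
Lemma card_nbhd_star x (A : {set 'S_n.+1}) :
  #|closed_nbhd E x :&: A| = (\sum_j ((star j * x)%g \in A))%N.
Proof.
rewrite -sum1_card big_mkcond (bigID [in closed_nbhd E x]) /= [X in (_ + X)%N]big1.
  rewrite addn0 closed_nbhd_star big_imset /=; last by move=> i j _ _ /star_inj.
  by apply: eq_big => // j _; 
    rewrite in_setI (imset_f (fun j => star j * x)) //; case: (_ \in A).
by move=> y /negPf y0; rewrite inE y0.
Qed.

Lemma star_graph_sym : symmetric E.
Proof.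
move=> x y; apply/idP/idP=> /star_graphP[j j0 ->];
by apply/star_graphP; exists j; rewrite // starK.
Qed.

Lemma star_graph_irr : irreflexive E.
Proof.
move=> x; apply/negbTE/negP=> /star_graphP[j j0 xE].
have : star ord0 * x = star j * x by rewrite star0 mul1g.
by move/star_inj=> jE; rewrite -jE eqxx in j0.
Qed.

Lemma card_closed_nbhd_star x : #|closed_nbhd E x| = n.+1.
Proof. by rewrite closed_nbhd_star card_imset ?card_ord //; apply: star_inj. Qed.

Lemma star_graph_regular : regular E n.
Proof.
move=> x; apply: succn_inj; rewrite -[RHS](card_closed_nbhd_star x).
rewrite (_ : closed_nbhd E x = x |: [set z | E x z]).
  by rewrite cardsU1 inE star_graph_irr.
by apply/setP=> z; rewrite !inE.
Qed.

Lemma star_graph_far x : 1 < n ->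
  exists y z, [/\ E x y, E y z, z != x & ~~ E x z].
Proof.
move=> n1; pose i : 'I_n.+1 := inord 1; pose j : 'I_n.+1 := inord 2.
have i0 : i != ord0 by rewrite -val_eqE /= inordK; lia.
have j0 : j != ord0 by rewrite -val_eqE /= inordK; lia.
have ij : j != i by rewrite -val_eqE /= !inordK; lia.
exists (star i * x), (star j * (star i * x)).
have odd_star k : k != ord0 -> odd_perm (star k) by rewrite odd_tperm eq_sym.
split; [by apply/star_graphP; exists i | by apply/star_graphP; exists j | |].
- apply/eqP=> zx; case/eqP: ij; apply: (@star_inj x) => /=.
  by rewrite -{1}zx starK.
(* Parity: [star k] is odd, whereas a product of two star transpositions is even. *)
- apply/star_graphP=> -[k k0]; rewrite mulgA => /mulIg/(congr1 (@odd_perm _)).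
  by rewrite odd_permM !odd_star.
Qed.

(** On a ball [k] is an injective map between sets of the same size, so it takes the value [a]
    exactly once. *)
Lemma exact_code_star (k : 'S_n.+1 -> 'I_n.+1) a :
  (forall x, injective (fun j => k (star j * x))) ->
  exact_code E [set w | k w == a].
Proof.
move=> kinj x; rewrite card_nbhd_star.
have [j jE] : exists j, k (star j * x) = a.
  by have [g _ gK] := injF_bij (kinj x); exists (g a).
rewrite (bigD1 j) //= inE jE eqxx big1 ?addn0 // => i.
by rewrite -(inj_eq (kinj x)) jE inE => /negPf->.
Qed.

Lemma perfect_code_star (C : {set 'S_n.+1}) :
  1 < n -> exact_code E C -> perfect_code E C.
Proof.
move=> n1 exC; have C0 : C != set0.
  by apply: contra_eq_neq (exC 1) => ->; rewrite setI0 cards0.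
apply: (exact_code_perfect star_graph_sym star_graph_irr star_graph_regular) => //.
by move=> x; apply: star_graph_far.
Qed.

Lemma card_exact_code_star (C : {set 'S_n.+1}) : exact_code E C -> #|C| = n`!.
Proof.
move=> exC; have := sum_card_nbhd C star_graph_sym card_closed_nbhd_star.
under eq_bigr do rewrite exC.
by rewrite sum1_card card_Sn factS mulnC => /eqP; rewrite eqn_pmul2r // => /eqP.
Qed.

End StarGraph.

(** * The kernel of A + 1, that is, the eigenspace for the eigenvalue -1 *)

Section StarKernel.
Variable n : nat.
Implicit Types (f g : 'S_n.+1 -> int) (v w : 'S_n.+1).
Local Open Scope ring_scope.

Definition star_ker f : Prop := forall x, \sum_j f (star j * x)%g = 0.

(** Right multiplications are automorphisms of the Star graph. This carries identities at 1 to every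
    vertex. *)
Lemma star_ker_mulr f w : star_ker f -> star_ker (fun v => f (v * w)%g).
Proof. by move=> fK x; under eq_bigr do rewrite -mulgA; apply: fK. Qed.

Lemma star_ker_sum0 f : star_ker f -> \sum_v f v = 0.
Proof.
move=> fK; have : \sum_(j : 'I_n.+1) \sum_v f (star j * v)%g = 0.
  by rewrite exchange_big big1 //= => v _; apply: fK.
have E j : \sum_v f (star j * v)%g = \sum_v f v.
  by rewrite [RHS](reindex_inj (mulgI (star j))).
under eq_bigr do rewrite E.
by rewrite sumr_const => /eqP; rewrite mulrn_eq0 => /orP[|/eqP] //; rewrite card_ord.
Qed.

(* K is in the image of the symmetric operator A + 1, so it is orthogonal to
   the kernel of A + 1. *)
Lemma star_ker_orth f (K : seq nat -> int) :
  star_preimage n.+1 K -> star_ker f -> \sum_v K (word v) * f v = 0.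
Proof.
move=> /allP KP fK.
have KE v : K (word v) = \sum_j preimage_coef n.+1 (word (star j * v)%g).
  by rewrite -sum_starE (eqP (KP _ (word_mem v))).
under eq_bigr do rewrite KE mulr_suml.
rewrite exchange_big /=.
under eq_bigr => j _.
  rewrite (reindex_inj (mulgI (star j))) /=.
  under eq_bigr do rewrite starK.
  over.
rewrite exchange_big big1 //= => v _.
by rewrite -mulr_sumr fK mulr0.
Qed.

End StarKernel.

(** Orthogonality to this function says that f(1) is the average of f over the (n-1)! permutations
    fixing 0. The factor [d] scales the identity so that the integer table [preimage_coef] provides
    a preimage. *)
Definition value_defect (d n : nat) (w : seq nat) : int :=
  ((if w == iota 0 n then (d * n.-1`!)%N%:Z else 0)
   - (if nth 0%N w 0 == 0%N then d%:Z else 0))%R.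

Lemma star_preimage_value :
  all (fun p => star_preimage p.1 (value_defect p.2 p.1))
    [:: (3, 1); (4, 2); (5, 3)].
Proof. by vm_compute. Qed.

(* Orthogonality to K says that f is equal at 1, hence by translation at every
   point, to its average over the permutations with the same value at 0. *)
Lemma star_ker_small n (f : 'S_n.+1 -> int) (v w : 'S_n.+1) :
  n.+1 \in [:: 3; 4; 5] -> star_ker f -> v ord0 = w ord0 -> f v = f w.
Proof.
move=> n35 fK; have [d d0 dn] : exists2 d, 0 < d & star_preimage n.+1 (value_defect d n.+1).
  have /allP P := star_preimage_value; exists n.-1; first by move: n35; rewrite !inE; lia.
  by apply: (P (n.+1, n.-1)); move: n35; rewrite !inE /= => /or3P[] /eqP[->].
have avg u : ((d * n`!)%N%:Z * f u = d%:Z * \sum_(t : 'S_n.+1 | t ord0 == u ord0) f t)%R.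
  have := star_ker_orth dn (star_ker_mulr u fK); rewrite /value_defect.
  under eq_bigr do rewrite word_eq1 mulrBl.
  rewrite sumrB => /eqP; rewrite subr_eq0 => /eqP.
  rewrite (bigD1 1%g) //= eqxx mul1g big1 ?addr0 => [->|t /negPf-> //]; last by rewrite mul0r.
  rewrite mulr_sumr [RHS]big_mkcond [RHS](reindex_inj (mulIg u)) /=; apply: eq_bigr => t _.
  rewrite nth_word0 permM (inj_eq perm_inj) -val_eqE /=.
  by case: ifP => _; rewrite ?mul0r.
move=> vw; have := avg v; rewrite vw -avg => /eqP.
rewrite -subr_eq0 -mulrBr mulf_eq0 => /orP[/eqP[/eqP]|].
  by rewrite muln_eq0 => /orP[]; [case: d d0 dn avg | rewrite eqn0Ngt fact_gt0].
by rewrite subr_eq0 => /eqP.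
Qed.

(** * Bitrades as kernel functions, and the cases n = 3, 4, 5 *)

Section Bitrades.
Variable n : nat.
Implicit Types (T : {set 'S_n.+1}) (u v w x : 'S_n.+1).
Local Notation E := (@star_graph n.+1).

Definition bitrade_fun T0 T1 w : int := ((w \in T0)%:R - (w \in T1)%:R)%R.

Lemma bitrade_fun_ker T0 T1 :
  perfect_bitrade E T0 T1 -> star_ker (bitrade_fun T0 T1).
Proof.
case=> _ _ bal x; rewrite sumrB -!natr_sum -!card_nbhd_star.
by have [-> _] := bal x; rewrite subrr.
Qed.

Lemma bitrade_fun_in0 T0 T1 w :
  [disjoint T0 & T1] -> (w \in T0) = (bitrade_fun T0 T1 w == 1%R).
Proof.
move=> dis; rewrite /bitrade_fun; case: (boolP (w \in T0)) => [w0|_].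
  by rewrite (disjointFr dis w0).
by case: (w \in T1).
Qed.

Lemma bitrade_fun_in1 T0 T1 w :
  [disjoint T0 & T1] -> (w \in T1) = (bitrade_fun T0 T1 w == -1)%R.
Proof.
move=> dis; rewrite /bitrade_fun; case: (boolP (w \in T1)) => [w1|_].
  by rewrite (disjointFl dis w1).
by case: (w \in T0).
Qed.

(** Disjointness makes [T0] and [T1] the level sets of the function at 1 and -1, and 1_X - 1_Y takes
    these values exactly on the two differences. *)
Lemma bitrade_fun_codes T0 T1 X Y : [disjoint T0 & T1] ->
  (forall w, bitrade_fun T0 T1 w = bitrade_fun X Y w) ->
  T0 = X :\: Y /\ T1 = Y :\: X.
Proof.
move=> dis fE; split; apply/setP=> w.
  rewrite (bitrade_fun_in0 w dis) fE inE /bitrade_fun.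
  by case: (w \in X); case: (w \in Y).
rewrite (bitrade_fun_in1 w dis) fE inE /bitrade_fun.
by case: (w \in X); case: (w \in Y).
Qed.

(** The ball around a point of [T0] or [T1] meets one of them, hence both by balance. *)
Lemma bitrade_nbhd T0 T1 : perfect_bitrade E T0 T1 ->
  exists w (j k : 'I_n.+1), (star j * w)%g \in T0 /\ (star k * w)%g \in T1.
Proof.
case=> neq dis bal.
have [w wT] : exists w, (w \in T0) || (w \in T1).
  apply/existsP; apply: contraNT neq; rewrite negb_exists => /forallP no.
  by apply/eqP/setP=> w; have := no w; rewrite negb_or => /andP[/negPf-> /negPf->].
have w_nbhd : w \in closed_nbhd E w by rewrite inE eqxx.
have [eq_card _] := bal w.
have gt0 : 0 < #|closed_nbhd E w :&: T0|.
  case/orP: wT => wT; first by apply/card_gt0P; exists w; apply/setIP.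
  by rewrite eq_card; apply/card_gt0P; exists w; apply/setIP.
have /card_gt0P[u /setIP[]] := gt0; rewrite eq_card in gt0.
have /card_gt0P[u' /setIP[]] := gt0.
rewrite closed_nbhd_star => /imsetP[k _ ->] kT /imsetP[j _ ->] jT.
by exists w, j, k.
Qed.

Definition value_code (a : 'I_n.+1) : {set 'S_n.+1} := [set w : 'S_n.+1 | w ord0 == a].

Lemma exact_value_code a : exact_code E (value_code a).
Proof. by apply: exact_code_star => x i j; rewrite !permM !tpermL => /perm_inj. Qed.

(** Here [T0] and [T1] are unions of value codes. Every ball meets every value code, so meeting [T0]
    or [T1] at most once leaves room for a single one. *)
Lemma bitrade_value_codes T0 T1 :
  (forall v w, v ord0 = w ord0 -> bitrade_fun T0 T1 v = bitrade_fun T0 T1 w) ->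
  perfect_bitrade E T0 T1 ->
  exists a b, [/\ a != b, T0 = value_code a & T1 = value_code b].
Proof.
move=> fval bt; have [_ dis bal] := bt; have [w [j [k [jT kT]]]] := bitrade_nbhd bt.
have codeE T i : (star i * w)%g \in T -> #|closed_nbhd E w :&: T| <= 1 ->
    (forall u v, u ord0 = v ord0 -> (u \in T) = (v \in T)) -> T = value_code (w i).
  move=> iT card1 Tval; apply/setP=> v; rewrite inE; apply/idP/eqP=> [vT|vi].
    (* The vertex [star l * w] of the ball has the same value at 0 as [v], hence lies in [T]. *)
    pose l := (w^-1)%g (v ord0).
    have lT : (star l * w)%g \in T.
      by rewrite (Tval _ v) // permM tpermL permKV.
    suff <- : l = i by rewrite permKV.
    apply: (@star_inj _ w); apply: (card_le1_eqP card1);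
    by rewrite inE closed_nbhd_star (imset_f (fun i => star i * w)%g) ?inE.
  by rewrite (Tval _ (star i * w)%g) // permM tpermL.
have T0E : T0 = value_code (w j).
  apply: codeE => // [|u v uv]; first by case: (bal w).
  by rewrite !(bitrade_fun_in0 _ dis) (fval u v).
have T1E : T1 = value_code (w k).
  apply: codeE => // [|u v uv]; first by case: (bal w) => <-.
  by rewrite !(bitrade_fun_in1 _ dis) (fval u v).
exists (w j), (w k); split=> //; apply: contraTneq dis => jk.
by rewrite T0E T1E jk -setI_eq0 setIid -T1E; apply/set0Pn; exists (star k * w)%g.
Qed.

(** [T0] and [T1] are themselves disjoint perfect codes, so they serve as [C] and [C']. *)
Lemma small_bitrade T0 T1 : n.+1 \in [:: 3; 4; 5] ->
  perfect_bitrade E T0 T1 -> embeddable E T0 T1 /\ #|T0| = n`!.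
Proof.
move=> n35 bt; have [_ dis _] := bt.
have [|a [b [_ T0E T1E]]] := bitrade_value_codes _ bt.
  by move=> v w; apply: star_ker_small => //; apply: bitrade_fun_ker.
have n1 : 1 < n by move: n35; rewrite !inE; lia.
split; last by rewrite T0E; apply/card_exact_code_star/exact_value_code.
exists T0, T1; rewrite {1}T0E {1}T1E; split; try exact/perfect_code_star/exact_value_code.
  by apply/esym/setDidPl.
by apply/esym/setDidPl; rewrite disjoint_sym.
Qed.

End Bitrades.

(** * The exotic action of Sym_6 *)

(* The six totals (1-factorizations of K_6). Each of their five synthemes is
   written as the word of a fixed-point free involution. *)
Definition totals : seq (seq (seq nat)) :=
  [:: [:: [:: 1; 0; 3; 2; 5; 4]; [:: 2; 4; 0; 5; 1; 3]; [:: 3; 5; 4; 0; 2; 1];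
          [:: 4; 3; 5; 1; 0; 2]; [:: 5; 2; 1; 4; 3; 0]];
      [:: [:: 1; 0; 3; 2; 5; 4]; [:: 2; 5; 0; 4; 3; 1]; [:: 3; 4; 5; 0; 1; 2];
          [:: 4; 2; 1; 5; 0; 3]; [:: 5; 3; 4; 1; 2; 0]];
      [:: [:: 1; 0; 4; 5; 2; 3]; [:: 2; 3; 0; 1; 5; 4]; [:: 3; 4; 5; 0; 1; 2];
          [:: 4; 5; 3; 2; 0; 1]; [:: 5; 2; 1; 4; 3; 0]];
      [:: [:: 1; 0; 4; 5; 2; 3]; [:: 2; 5; 0; 4; 3; 1]; [:: 3; 2; 1; 0; 5; 4];
          [:: 4; 3; 5; 1; 0; 2]; [:: 5; 4; 3; 2; 1; 0]];
      [:: [:: 1; 0; 5; 4; 3; 2]; [:: 2; 3; 0; 1; 5; 4]; [:: 3; 5; 4; 0; 2; 1];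
          [:: 4; 2; 1; 5; 0; 3]; [:: 5; 4; 3; 2; 1; 0]];
      [:: [:: 1; 0; 5; 4; 3; 2]; [:: 2; 4; 0; 5; 1; 3]; [:: 3; 2; 1; 0; 5; 4];
          [:: 4; 5; 3; 2; 0; 1]; [:: 5; 3; 4; 1; 2; 0]]].

Definition partner (t : seq (seq nat)) (p q r : nat) : nat :=
  nth 0%N (nth [::] t (find (fun s => eqn (nth 0%N s p) q) t)) r.

(* A total is determined by the partner of 2 in the syntheme through {0, 1} and
   the partner of 1 in the syntheme through {0, 2}; this locates the image of
   the i-th total under w. *)
Definition tot_nat (w : seq nat) (i : nat) : nat :=
  let t := nth [::] totals i in
  let p := index 0 w in let q := index 1 w in let r := index 2 w in
  index (nth 0 w (partner t p q r), nth 0 w (partner t p r q))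
    [:: (3, 4); (3, 5); (4, 3); (4, 5); (5, 3); (5, 4)].

Definition gen (j : nat) : seq nat := swap0 (iota 0 6) j.

Lemma tot_nat_lt : all (fun w => all (fun i => tot_nat w i < 6) (iota 0 6)) (words 6).
Proof. by vm_compute. Qed.

(** Multiplicativity of the action when the left factor is a star transposition; [totM] extends it
    to all permutations. *)
Lemma tot_nat_swap0 :
  all (fun w => all (fun j => let w' := swap0 w j in
    all (fun i => eqn (tot_nat w' i) (tot_nat w (tot_nat (gen j) i)))
      (iota 0 6)) (iota 0 6)) (words 6).
Proof. by vm_compute. Qed.

Lemma tot_nat_faithful :
  all (fun w => all (fun i => eqn (tot_nat w i) i) (iota 0 6) ==> (w == iota 0 6))
    (words 6).
Proof. by vm_compute. Qed.

Lemma all_iota_ord n (P : pred nat) : all P (iota 0 n) -> forall i : 'I_n, P i.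
Proof. by move=> /allP aP i; apply: aP; rewrite mem_iota add0n ltn_ord. Qed.

Section Totals.
Implicit Types (u v w : 'S_6) (i j k : 'I_6).
Local Open Scope group_scope.

Definition tot v i : 'I_6 := inord (tot_nat (word v) i).

Lemma val_tot v i : tot v i = tot_nat (word v) i :> nat.
Proof. by rewrite inordK // (all_iota_ord (allP tot_nat_lt _ (word_mem v))). Qed.

Lemma word_gen j : word (star j) = gen j.
Proof. by rewrite -[star j]mulg1 word_star word1. Qed.

Lemma tot_star j w i : tot (star j * w) i = tot w (tot (star j) i).
Proof.
apply: val_inj; rewrite /= !val_tot word_star word_gen; apply/eqP.
exact: (all_iota_ord (all_iota_ord (allP tot_nat_swap0 _ (word_mem w)) j) i).
Qed.

Lemma tot1 i : tot 1 i = i.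
Proof. by apply: val_inj; rewrite /= val_tot word1; case: i => -[|[|[|[|[|[|]]]]]]. Qed.

(** Permutations are products of transpositions, and (x y) = (0 x)(0 y)(0 x), which reduces the
    claim to [tot_star]. *)
Lemma totM v w i : tot (v * w) i = tot w (tot v i).
Proof.
have [ts -> _] := prod_tpermP v; elim: ts w i => [|t ts IH] w i.
  by rewrite big_nil mul1g tot1.
rewrite big_cons -mulgA.
suff tot_tperm x y u k : tot (tperm x y * u) k = tot u (tot (tperm x y) k).
  by rewrite !tot_tperm IH.
have [->|x0] := eqVneq x ord0; first exact: tot_star.
have [->|y0] := eqVneq y ord0; first by rewrite tpermC; apply: tot_star.
have [->|xy] := eqVneq x y; first by rewrite tperm1 mul1g tot1.
have -> : tperm x y = star x * (star y * star x).
  by rewrite mulgA -{1}[star x]tpermV -mulgA -conjgE tpermJ tpermL tpermD // eq_sym.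
by rewrite -!mulgA !tot_star.
Qed.

Lemma tot_inj v : injective (tot v).
Proof. by apply: (can_inj (g := tot v^-1)) => i; rewrite -totM mulgV tot1. Qed.

Definition outer v : 'S_6 := perm (@tot_inj v).

Lemma outerE v i : outer v i = tot v i. Proof. exact: permE. Qed.

Lemma outerM v w : outer (v * w) = outer v * outer w.
Proof. by apply/permP=> i; rewrite permM !outerE totM. Qed.

Lemma outer_inj : injective outer.
Proof.
move=> u v uv; apply/eqP; rewrite -(inj_eq (mulIg v^-1)) mulgV -word_eq1.
apply: (implyP (allP tot_nat_faithful _ (word_mem _))).
apply/allP=> i; rewrite mem_iota add0n => /andP[_ lti].
have := val_tot (u * v^-1) (Ordinal lti); rewrite totM -!outerE uv !outerE -totM.
by rewrite mulgV tot1 /= => <-; apply/eqnP.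
Qed.

Lemma outer_surj w : exists v, outer v = w.
Proof. by have [g _ gK] := injF_bij outer_inj; exists (g w). Qed.

(** This is what makes every D_ik meet each ball exactly once. *)
Lemma outer_star_inj i : injective (fun j => outer (star j) i).
Proof.
have : all (fun b => uniq [seq tot_nat (gen a) b | a <- iota 0 6]) (iota 0 6).
  by vm_compute.
move=> /all_iota_ord/(_ i); rewrite -val_enum_ord -map_comp.
move=> /injectiveP j_inj j k /= jk; apply: j_inj => /=.
by rewrite -!word_gen -!val_tot -!outerE jk.
Qed.

End Totals.

(** * Expansion of a kernel function for n = 6 *)

Lemma words_word n (s : seq nat) :
  s \in words n.+1 -> exists v : 'S_n.+1, word v = s.
Proof.
rewrite mem_permutations => sP.
have sz : size s = n.+1 by rewrite (perm_size sP) size_iota.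
have lt_s i : i < n.+1 -> nth 0 s i < n.+1.
  move=> lti; have : nth 0 s i \in iota 0 n.+1 by rewrite -(perm_mem sP) mem_nth ?sz.
  by rewrite mem_iota.
have s_inj : injective (fun i : 'I_n.+1 => inord (nth 0 s i) : 'I_n.+1).
  move=> i j /(congr1 val) /=; rewrite !inordK ?lt_s // => /eqP.
  rewrite nth_uniq ?sz ?(perm_uniq sP) ?iota_uniq // => /eqP; apply: val_inj.
exists (perm s_inj); apply: (@eq_from_nth _ 0) => [|i]; rewrite size_word ?sz // => lti.
by rewrite (nth_word _ (Ordinal lti)) permE inordK ?lt_s.
Qed.

Lemma perm_2transitive n (i j a b : 'I_n) :
  i != j -> a != b -> exists w : 'S_n, w i = a /\ w j = b.
Proof.
move=> ij ab; pose t := tperm i a j.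
have ta : t != a by rewrite -(tpermL i a) (inj_eq perm_inj) eq_sym.
exists (tperm i a * tperm t b)%g; rewrite !permM tpermL tpermL; split=> //.
by rewrite tpermD // eq_sym.
Qed.

Lemma sum_fibers (T I : finType) (h : T -> I) (f : T -> int) (F : I -> int) :
  (\sum_v f v * F (h v) = \sum_a F a * \sum_(v | h v == a) f v)%R.
Proof.
rewrite (partition_big h xpredT) //=; apply: eq_bigr => a _.
by rewrite mulr_sumr; apply: eq_bigr => v /eqP <-; rewrite mulrC.
Qed.

(** The [count] is the number of totals fixed by w, so orthogonality to this function is the
    expansion formula at the identity. *)
Definition outer_defect (w : seq nat) : int :=
  ((if w == iota 0 6 then 720 else 0) - (if nth 0%N w 0 == 0%N then 6 else 0)
   - (5 * count (fun i => eqn (tot_nat w i) i) (iota 0 6))%N%:Z)%R.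

Lemma star_preimage_outer : star_preimage 6 outer_defect.
Proof. by vm_compute. Qed.

Section Kernel6.
Variable f : 'S_6 -> int.
Hypothesis fK : star_ker f.
Implicit Types (u v w : 'S_6) (a b i j k l : 'I_6).
Local Open Scope ring_scope.

Definition value_sum a : int := \sum_(v : 'S_6 | v ord0 == a) f v.
Definition total_sum i k : int := \sum_(v : 'S_6 | outer v i == k) f v.
Local Notation s := value_sum.
Local Notation S := total_sum.

Lemma sum_value_sum : \sum_a s a = 0.
Proof.
have := sum_fibers (fun v : 'S_6 => v ord0) f (fun=> 1).
by under eq_bigr do rewrite mulr1; under [RHS]eq_bigr do rewrite mul1r; rewrite star_ker_sum0.
Qed.

Lemma sum_total_sumr i : \sum_k S i k = 0.
Proof.
have := sum_fibers (fun v : 'S_6 => outer v i) f (fun=> 1).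
by under eq_bigr do rewrite mulr1; under [RHS]eq_bigr do rewrite mul1r; rewrite star_ker_sum0.
Qed.

Lemma sum_total_suml k : \sum_i S i k = 0.
Proof.
rewrite /S; under eq_bigr do rewrite big_mkcond.
rewrite exchange_big /= -[RHS](star_ker_sum0 fK); apply: eq_bigr => v _.
rewrite (reindex_inj (@perm_inj _ (outer v)^-1%g)) /= (bigD1 k) //=.
by rewrite permKV eqxx big1 ?addr0 // => i /negPf ik; rewrite permKV ik.
Qed.

(** Orthogonality to [outer_defect] is applied to the translate of [f] by [w]. As [outer] is
    multiplicative, the sums of the translate over the codes C_0 and D_ii containing 1 are those of
    [f] over the codes of the same kind containing [w]. *)
Lemma expansion w : 720 * f w = 6 * s (w ord0) + 5 * \sum_i S i (outer w i).
Proof.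
have := star_ker_orth star_preimage_outer (star_ker_mulr w fK); rewrite /outer_defect.
under eq_bigr do rewrite !mulrBl word_eq1 nth_word0.
rewrite !sumrB (bigD1 1%g) //= eqxx mul1g big1 ?addr0 => [|v /negPf->]; last by rewrite mul0r.
have -> : \sum_(v : 'S_6) (if val (v ord0) == 0%N then 6 else 0) * f (v * w)%g = 6 * s (w ord0).
  rewrite mulr_sumr [RHS]big_mkcond [RHS](reindex_inj (mulIg w)) /=.
  apply: eq_bigr => v _; rewrite permM (inj_eq perm_inj) -val_eqE /=.
  by case: ifP => _; rewrite ?mul0r.
suff ->: \sum_v (5 * count (fun m => eqn (tot_nat (word v) m) m) (iota 0 6))%N%:Z * f (v * w)%g
  = 5 * \sum_i S i (outer w i).
  by move/eqP; rewrite -addrA -opprD subr_eq0 => /eqP->.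
transitivity (5 * \sum_v \sum_i (outer v i == i)%:R * f (v * w)%g).
  rewrite mulr_sumr; apply: eq_bigr => v _; rewrite -mulr_suml mulrA; congr (_ * _).
  rewrite -natr_sum PoszM; congr (_ * _); rewrite natz; congr Posz.
  rewrite -val_enum_ord count_map -sum1_count big_enum_cond big_mkcond /=.
  by apply: eq_bigr => i _; rewrite outerE -val_eqE /= val_tot; case: eqnP; case: eqP.
congr (_ * _); rewrite exchange_big; apply: eq_bigr => i _ /=.
rewrite /S [RHS]big_mkcond [RHS](reindex_inj (mulIg w)) /=; apply: eq_bigr => v _.
by rewrite outerM permM (inj_eq perm_inj); case: eqP; rewrite ?mul1r ?mul0r.
Qed.

Lemma norm_expansion :
  720 * \sum_w f w ^+ 2 = 6 * \sum_a s a ^+ 2 + 5 * \sum_i \sum_k S i k ^+ 2.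
Proof.
pose A := \sum_w f w * s (w ord0); pose B := \sum_i \sum_w f w * S i (outer w i).
have -> : \sum_a s a ^+ 2 = A.
  exact/esym/(sum_fibers (fun v : 'S_6 => v ord0) f s).
have -> : \sum_i \sum_k S i k ^+ 2 = B.
  apply: eq_bigr => i _.
  exact/esym/(sum_fibers (fun v : 'S_6 => outer v i) f (S i)).
rewrite /A /B [X in 5 * X]exchange_big !mulr_sumr -big_split; apply: eq_bigr => w _ /=.
rewrite expr2 mulrCA expansion mulrDr mulrCA [f w * (5 * _)]mulrCA.
by congr (_ + 5 * _); apply: mulr_sumr.
Qed.

End Kernel6.

(** * Divisibility of differences of code sums *)

Definition syntheme : seq nat := [:: 1; 0; 3; 2; 5; 4].
Definition double_swap : seq nat := [:: 2; 3; 0; 1; 4; 5].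
Definition syntheme' : seq nat := [:: 3; 2; 1; 0; 5; 4].

(** The words are (0 1)(2 3)(4 5), (0 2)(1 3) and (0 3)(1 2)(4 5), the nontrivial elements of a
    Klein four-group. *)
Lemma klein_words :
  [/\ syntheme \in words 6, double_swap \in words 6, syntheme' \in words 6 &
   all (fun i => let z := tot_nat double_swap i in
     let h := tot_nat syntheme i in let h' := tot_nat syntheme' i in
     (eqn h i && eqn h' z) || (eqn h z && eqn h' i)) (iota 0 6)].
Proof. by split; vm_compute. Qed.

Section Integrality.
Variable f : 'S_6 -> int.
Hypothesis fK : star_ker f.
Implicit Types (u v w h z : 'S_6) (a b i j k l : 'I_6).
Local Open Scope ring_scope.
Local Notation s := (value_sum f).
Local Notation S := (total_sum f).

(* [outer h] and [outer h'] are disjoint transpositions with product [outer z], so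
   {i, outer z i} = {outer h i, outer h' i} for every i and the total sums cancel. *)
Lemma value_sum_klein w : exists m : int,
  s (w ord0) + s (w (inord 2)) - s (w (inord 1)) - s (w (inord 3)) = 120 * m.
Proof.
have [/words_word[h hE] /words_word[z zE] /words_word[h' h'E] kl] := klein_words.
have at0 v (m : nat) : nth 0%N (word v) 0 = m -> v ord0 = inord m.
  by rewrite nth_word0 => <-; rewrite inord_val.
(* The alternating sum of [expansion] over the four-group: the total sums cancel, and 720 / 6 =
   120. *)
exists (f w + f (z * w)%g - f (h * w)%g - f (h' * w)%g).
have exp v := expansion fK (v * w)%g.
have sumS0 : \sum_i S i (outer w i) + \sum_i S i (outer (z * w)%g i)
    = \sum_i S i (outer (h * w)%g i) + \sum_i S i (outer (h' * w)%g i).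
  rewrite -!big_split; apply: eq_bigr => i _ /=; rewrite !outerM !permM.
  have := all_iota_ord kl i; rewrite -hE -zE -h'E -!val_tot.
  by case/orP=> /andP[/eqnP/val_inj e /eqnP/val_inj e']; rewrite !outerE e e' // addrC.
have := exp z; have := exp h; have := exp h'; have := expansion fK w.
rewrite !permM (at0 h 1%N) ?hE // (at0 z 2%N) ?zE // (at0 h' 3%N) ?h'E //.
lia.
Qed.

(** [value_sum_klein] is used at [w] and at [star i4 * w]. These agree at 1, 2, 3, so subtracting
    leaves [w ord0] against [w i4]. *)
Lemma value_sum_mod a b : exists m : int, s a - s b = 120 * m.
Proof.
have [->|ab] := eqVneq a b; first by exists 0; rewrite subrr mulr0.
pose i4 : 'I_6 := inord 4.
have ne (m m' : nat) : (m < 6)%N -> (m' < 6)%N -> m != m' -> inord m != inord m' :> 'I_6.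
  by move=> ? ?; rewrite -val_eqE /= !inordK.
have i04 : ord0 != i4 by rewrite -val_eqE /= inordK.
have [w [<- <-]] := perm_2transitive i04 ab.
have [m1] := value_sum_klein w; have [m2] := value_sum_klein (star i4 * w)%g.
rewrite !permM tpermL !tpermD ?ne //; try by rewrite -val_eqE /= !inordK.
by exists (m1 - m2); lia.
Qed.

(** Let [outer h] swap [i] and [j]. In the difference of the expansions at [w] and [h * w] only four
    total sums survive. The value sums contribute a multiple of 6 * 120 = 720, so 5 times the second
    difference is divisible by 720. *)
Lemma total_sum_mod i j k l : exists m : int,
  S i k + S j l - S i l - S j k = 144 * m.
Proof.
have [->|ij] := eqVneq i j; first by exists 0; rewrite mulr0; lia.
have [->|kl] := eqVneq k l; first by exists 0; rewrite mulr0; lia.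
have [h hE] := outer_surj (tperm i j); have [v [vi vj]] := perm_2transitive ij kl.
have [w wE] := outer_surj v; rewrite -wE in vi vj.
have [m sE] := value_sum_mod (w ord0) ((h * w)%g ord0).
exists (f w - f (h * w)%g - m).
have := expansion fK w; have := expansion fK (h * w)%g.
have split_sum u : \sum_m S m (outer u m) =
    S i (outer u i) + S j (outer u j) + \sum_(m | (m != i) && (m != j)) S m (outer u m).
  by rewrite (bigD1 i) //= (bigD1 j) 1?eq_sym //= addrA.
rewrite !split_sum outerM hE !permM tpermL tpermR vi vj.
have -> : \sum_(m | (m != i) && (m != j)) S m ((tperm i j * outer w)%g m) =
    \sum_(m | (m != i) && (m != j)) S m (outer w m).
  by apply: eq_bigr => x /andP[xi xj]; rewrite permM tpermD // eq_sym.
by move: sE; rewrite permM; lia.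
Qed.

End Integrality.

(** * Integer matrices of small spread *)

Section SmallVectors.
Local Open Scope ring_scope.
Implicit Types (d g : 'I_6 -> int) (k l : 'I_6) (t : int).

Definition spread d : int := \sum_k \sum_l (d k - d l) ^+ 2.

Lemma spread_ge0 d : 0 <= spread d.
Proof. by apply: sumr_ge0 => k _; apply: sumr_ge0 => l _; apply: sqr_ge0. Qed.

Lemma spread_shift d g t : (forall k, d k = g k + t) -> spread d = spread g.
Proof.
move=> dE; apply: eq_bigr => k _; apply: eq_bigr => l _.
by rewrite !dE; congr (_ ^+ 2); lia.
Qed.

Lemma spread_opp d g : (forall k, d k = - g k) -> spread d = spread g.
Proof.
move=> dE; apply: eq_bigr => k _; apply: eq_bigr => l _.
by rewrite !dE -opprD sqrrN.
Qed.

Lemma spreadE d : spread d = 12 * (\sum_k d k ^+ 2) - 2 * (\sum_k d k) ^+ 2.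
Proof.
have -> : spread d = \sum_k \sum_l (d k ^+ 2 + d l ^+ 2 - 2 * (d k * d l)).
  by apply: eq_bigr => k _; apply: eq_bigr => l _; ring.
under eq_bigr do rewrite sumrB big_split sumr_const card_ord -!mulr_sumr /=.
rewrite sumrB big_split sumr_const card_ord /= sumrMnl -!mulr_sumr -mulr_suml.
rewrite expr2; move: (\sum_k _) (\sum_k _) => A B.
by lia.
Qed.

Lemma spread_eq0 d : spread d = 0 -> exists t, forall k, d k = t.
Proof.
move=> d0; exists (d ord0) => k.
have dk : \sum_l (d k - d l) ^+ 2 = 0.
  by apply: (psumr_eq0P _ d0) => // i _; apply: sumr_ge0 => l _; apply: sqr_ge0.
have /eqP : (d k - d ord0) ^+ 2 = 0.
  by apply: (psumr_eq0P _ dk) => // l _; apply: sqr_ge0.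
by rewrite sqrf_eq0 subr_eq0 => /eqP.
Qed.

Lemma sum_sqr_eq1 (A : pred 'I_6) d : \sum_(k | A k) d k ^+ 2 = 1 ->
  exists k, [/\ A k, d k = 1 \/ d k = -1 & forall l, A l -> l != k -> d l = 0].
Proof.
move=> d1; have [/existsP[k /andP[Ak dk]]|/existsPn no] := boolP [exists k, A k && (d k != 0)].
  exists k; move: d1; rewrite (bigD1 k) //= => d1.
  have ge0 : 0 <= \sum_(i | A i && (i != k)) d i ^+ 2.
    by apply: sumr_ge0 => i _; apply: sqr_ge0.
  have split1 (x y : int) : 0 < x -> 0 <= y -> x + y = 1 -> x = 1 /\ y = 0 by lia.
  have [|dk1 r0] := split1 _ _ _ ge0 d1; first by rewrite exprn_even_gt0.
  split=> //; first by move/eqP: dk1; rewrite sqrf_eq1 => /orP[]/eqP; [left | right].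
  move=> l Al lk; apply/eqP; rewrite -sqrf_eq0; apply/eqP.
  by apply: (psumr_eq0P _ r0) => [i _|]; rewrite ?sqr_ge0 ?Al.
move: d1; rewrite big1 // => k Ak; have := no k.
by rewrite Ak negbK => /eqP ->; rewrite expr0n.
Qed.

Lemma sum_sqr_eq2 d : \sum_k d k ^+ 2 = 2 -> \sum_k d k = 0 ->
  exists k l, k != l /\ forall i, d i = (i == k)%:R - (i == l)%:R.
Proof.
move=> d2 d0.
have [/existsP[k dk]|/existsPn no] := boolP [exists k, d k > 0]; last first.
  have dz k : - d k = 0.
    apply: (psumr_eq0P (P := xpredT) (F := fun k => - d k)) => // [i _|].
      by rewrite oppr_ge0 leNgt; apply: no.
    by rewrite sumrN d0 oppr0.
  move: d2; rewrite big1 // => k _; have /eqP := dz k.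
  by rewrite oppr_eq0 => /eqP ->; rewrite expr0n.
move: d2 d0; rewrite !(bigD1 (P := xpredT) k) //= => d2 d0.
have ge0 : 0 <= \sum_(i | i != k) d i ^+ 2 by apply: sumr_ge0 => i _; apply: sqr_ge0.
have split2 (x y : int) : 0 < x -> 0 <= y -> x * x + y = 2 -> x = 1 /\ y = 1.
  move=> x0 y0; have [->|x2 e] : x = 1 \/ 2 <= x by lia.
    by lia.
  by have := ler_pM (isT : 0 <= 2 :> int) (isT : 0 <= 2 :> int) x2 x2; lia.
have [dk1 r1] := split2 _ _ dk ge0 d2.
rewrite dk1 in d0.
have [l [lk dl dz]] : exists l, [/\ l != k, d l = 1 \/ d l = -1 &
    forall i, i != k -> i != l -> d i = 0].
  exact: sum_sqr_eq1 r1.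
move: d0; rewrite (bigD1 l) //= big1 ?addr0 => [d0|i /andP[ik il]]; last by rewrite dz.
have {}dl : d l = -1 by case: dl d0 => ->.
exists k, l; split=> [|i]; first by rewrite eq_sym.
have [->|ik] := eqVneq i k; first by rewrite eq_sym (negPf lk) dk1.
by have [->|il] := eqVneq i l; rewrite ?dl ?dz.
Qed.

(** For each value of [e] the bounds are linear in [X], and the parity condition removes the
    remaining candidates. *)
Lemma spread_cases (X e m : int) :
  X = e + 2 * m -> -2 <= e -> e <= 3 ->
  0 <= 12 * X - 2 * e ^+ 2 -> 12 * X - 2 * e ^+ 2 <= 24 ->
  X = 0 /\ e = 0 \/ X = 1 /\ (e = 1 \/ e = -1) \/
  (X = 2 /\ (e = 2 \/ e = -2) \/ X = 3 /\ e = 3) \/ X = 2 /\ e = 0.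
Proof.
move=> Xe e_lo e_hi; rewrite expr2.
have [e1|[e1|[e1|[e1|[e1|e1]]]]] : e = -2 \/ e = -1 \/ e = 0 \/ e = 1 \/ e = 2 \/ e = 3 by lia.
all: by rewrite e1; lia.
Qed.

(* Shift d so that its sum e lies in [-2, 3]; then spread d = 12 X - 2 e^2 with
   X the sum of squares, which forces X <= 3. *)
Lemma spread_small d : spread d <= 24 -> exists t,
  [\/ spread d = 0 /\ (forall l, d l = t),
      spread d = 10 /\ (exists e k, (e = 1 \/ e = -1) /\ forall l, d l = t + e * (l == k)%:R),
      (spread d = 16 /\ exists e, (e = 2 \/ e = -2) /\ \sum_k d k = 6 * t + e) \/
      (spread d = 18 /\ \sum_k d k = 6 * t + 3) |
      spread d = 24 /\
        exists k k', k != k' /\ forall l, d l = t + (l == k)%:R - (l == k')%:R].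
Proof.
have [t [e [dt e_lo e_hi]]] : exists t e, [/\ \sum_k d k = 6 * t + e, -2 <= e & e <= 3].
  have divmod6 (x : int) : exists t e, [/\ x = 6 * t + e, -2 <= e & e <= 3].
    (* Shifting by 2 before dividing places the remainder in [-2, 3]. *)
    by exists ((x + 2) %/ 6)%Z, (((x + 2) %% 6)%Z - 2); split; lia.
  exact: divmod6.
pose g k := d k - t.
have sum_g : \sum_k g k = e.
  by rewrite sumrB dt sumr_const card_ord -mulr_natr; lia.
have dE k : d k = g k + t by rewrite /g; lia.
have ge0 := spread_ge0 d; move: ge0.
rewrite (spread_shift dE) spreadE sum_g; set X := \sum_k _ ^+ 2.
have X0 : 0 <= X by apply: sumr_ge0 => k _; apply: sqr_ge0.
(* An integer and its square have the same parity. *)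
have [m Xe] : exists m, X = e + 2 * m.
  have : (2 %| X - e)%Z.
    rewrite -sum_g -sumrB; apply: rpred_sum => k _.
    have [q [->|->]] : exists q, g k = 2 * q \/ g k = 2 * q + 1.
      by exists (g k %/ 2)%Z; lia.
    - by apply/dvdzP; exists (2 * q * q - q); rewrite expr2; ring.
    - by apply/dvdzP; exists (2 * q * q + q); rewrite expr2; ring.
  case/dvdzP => q Xq; exists q; lia.
move=> ge0 le24; exists t.
case: (spread_cases Xe e_lo e_hi ge0 le24) => [[X1 e1]|[[X1 e1]|[X1|[X1 e1]]]].
- constructor 1; rewrite X1 e1; split=> // l; rewrite dE.
  have /eqP : g l ^+ 2 = 0 by apply: (psumr_eq0P _ X1) => // i _; apply: sqr_ge0.
  by rewrite sqrf_eq0 => /eqP->; rewrite add0r.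
- constructor 2; split; first by rewrite X1; case: e1 => ->.
  have [k [_ gk gz]] := sum_sqr_eq1 X1; exists (g k), k; split=> // l; rewrite dE.
  by have [->|lk] := eqVneq l k; rewrite ?mulr1 ?mulr0 ?(gz l) //; lia.
- constructor 3; case: X1 => -[-> e1]; [left | right].
    by split; [case: e1 => -> | exists e].
  by rewrite dt e1.
- constructor 4; rewrite X1 e1; split=> //; rewrite e1 in sum_g.
  have [k [k' [kk' gE]]] := sum_sqr_eq2 X1 sum_g; exists k, k'; split=> // l.
  by rewrite dE gE; lia.
Qed.

End SmallVectors.

Lemma sum_delta n (k : 'I_n) : (\sum_i (i == k)%:R = 1 :> int)%R.
Proof. by rewrite (bigD1 k) //= eqxx big1 ?addr0 // => i /negPf->. Qed.

(** * Comparing the rows of an integer matrix with a fixed row *)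

Section Rows.
Local Open Scope ring_scope.
Variable N : 'I_6 -> 'I_6 -> int.
Implicit Types (i j k l r x y z : 'I_6) (D : {set 'I_6}).

Definition row_spread i j : int := spread (fun l => N i l - N j l).
Definition total_spread : int := \sum_i \sum_j row_spread i j.
Local Notation Q := row_spread.
Local Notation P := total_spread.

Lemma row_spread_ge0 i j : 0 <= Q i j. Proof. exact: spread_ge0. Qed.

Lemma row_spreadC i j : Q i j = Q j i.
Proof. by apply: spread_opp => l; rewrite opprB. Qed.

Lemma row_spread_eq0 i j : Q i j = 0 -> exists t, forall l, N i l = N j l + t.
Proof. by case/spread_eq0=> t tE; exists t => l; rewrite -(tE l); lia. Qed.

Lemma row_spread_trans i j k : Q i j = 0 -> Q i k = Q j k.
Proof.
by case/row_spread_eq0=> t tE; apply: (@spread_shift _ _ t) => l; rewrite tE; lia.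
Qed.

Lemma row_spread_values i j :
  [\/ Q i j = 0, Q i j = 10, Q i j = 16 | 18 <= Q i j].
Proof.
have [|gt24] := boolP (Q i j <= 24); last by constructor 4; move: gt24; lia.
case/spread_small=> t; rewrite -/(Q i j).
case=> [[e _]|[e _]|[[e _]|[e _]]|[e _]]; rewrite e.
- by constructor 1.
- by constructor 2.
- by constructor 3.
- by constructor 4.
- by constructor 4.
Qed.

Lemma row_spread_ge10 i j : Q i j != 0 -> 10 <= Q i j.
Proof. by case: (row_spread_values i j); lia. Qed.

(** Rows outside [D] are row [r] up to constants: two of them contribute 0, and a mixed pair
    contributes [Q i r], in both orders. *)
Lemma total_spread_split r D : (forall i, i \notin D -> Q i r = 0) ->
  P = 2 * (6 - #|D|%:Z) * (\sum_(i in D) Q i r) + \sum_(i in D) \sum_(j in D) Q i j.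
Proof.
move=> D0; have cardC : #|[predC D]|%:Z = 6 - #|D|%:Z.
  have -> : 6 = #|D|%:Z + #|[predC D]|%:Z by rewrite -PoszD cardC card_ord.
  by rewrite addrAC subrr add0r.
have sumR : \sum_j Q j r = \sum_(i in D) Q i r.
  by rewrite (bigID [in D]) /= [X in _ + X]big1 ?addr0.
rewrite /P (bigID [in D]) /=.
have -> : \sum_(i | i \notin D) \sum_j Q i j = (6 - #|D|%:Z) * \sum_(i in D) Q i r.
  rewrite -cardC -sumR -[Posz _]natz mulr_natl -sumr_const; apply: eq_bigr => i iD.
  by apply: eq_bigr => j _; rewrite (row_spread_trans _ (D0 i iD)) row_spreadC.
have -> : \sum_(i in D) \sum_j Q i j =
    \sum_(i in D) \sum_(j in D) Q i j + (6 - #|D|%:Z) * \sum_(i in D) Q i r.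
  rewrite mulr_sumr -big_split; apply: eq_bigr => i _ /=.
  rewrite (bigID [in D]) /=; congr (_ + _); rewrite -cardC -[Posz _]natz mulr_natl -sumr_const.
  apply: eq_bigr => j jD.
  by rewrite row_spreadC (row_spread_trans _ (D0 j jD)) row_spreadC.
by ring.
Qed.

(** Subtracting row [r] from all six rows does not change the total modulo a divisor [p] of 6. *)
Lemma sum_rows_mod (p q : int) r (u g : 'I_6 -> int) : p * q = 6 ->
  (forall i, \sum_l (N i l - N r l) = p * u i + g i) ->
  exists t, \sum_i \sum_l N i l = p * t + \sum_i g i.
Proof.
move=> pq ug; exists (\sum_i u i + q * \sum_l N r l).
have -> : \sum_i \sum_l N i l = \sum_i \sum_l (N i l - N r l) + 6 * \sum_l N r l.
  under [X in _ = X + _]eq_bigr do rewrite sumrB.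
  by rewrite sumrB sumr_const card_ord -[_ *+ 6]mulr_natl; ring.
under eq_bigr do rewrite ug.
by rewrite big_split -mulr_sumr -pq /=; ring.
Qed.

(** Averaging over the six rows: 240 / 6 = 40. *)
Lemma short_row : P <= 240 -> exists r, \sum_i Q i r <= 40.
Proof.
move=> P240; apply/existsP; rewrite -[X in is_true X]negbK negb_exists.
have gt40 (x : int) : ~~ (x <= 40) -> 41 <= x by lia.
apply/negP=> /forallP big; have : 41 * 6 <= P.
  have -> : 41 * 6 = \sum_(r < 6) 41 :> int by rewrite sumr_const card_ord.
  by rewrite /P exchange_big /=; apply: ler_sum => r _; apply/gt40/big.
by lia.
Qed.

(** The difference of the two rows has sum 2 or -2 modulo 6, whereas spread 0 forces sum 0 and
    spread 10 forces sum 1 or -1 modulo 6. *)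
Lemma row_spread_sign r i j (u u' e e' : int) k k' :
  (forall l, N i l = N r l + u + e * (l == k)%:R) ->
  (forall l, N j l = N r l + u' + e' * (l == k')%:R) ->
  e = 1 /\ e' = -1 \/ e = -1 /\ e' = 1 -> 16 <= Q i j.
Proof.
move=> iE jE ee'; have sumE : \sum_l (N i l - N j l) = 6 * (u - u') + (e - e').
  under eq_bigr do rewrite iE jE.
  rewrite (eq_bigr (fun l => (u - u') + (e * (l == k)%:R - e' * (l == k')%:R)));
    last by move=> l _; ring.
  rewrite big_split /= !sumrB -!mulr_sumr !sumr_const card_ord.
  rewrite -[u *+ _]mulr_natl -[u' *+ _]mulr_natl.
  by rewrite !sum_delta; lia.
have [|gt24] := boolP (Q i j <= 24); last by move: gt24; lia.
case/spread_small=> t; rewrite -/(Q i j).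
case=> [[_ dE]|[_ [e1 [k1 [e11 dE]]]]|[[-> _]|[-> _]]|[-> _]] //.
  move: sumE; under eq_bigr do rewrite dE.
  by rewrite sumr_const card_ord -mulr_natl; case: ee' => -[-> ->]; lia.
move: sumE; under eq_bigr do rewrite dE.
rewrite big_split sumr_const card_ord -mulr_sumr sum_delta /=.
by rewrite -mulr_natl; case: ee' => -[-> ->]; case: e11 => ->; lia.
Qed.

(** Up to constants, row i is row [r] plus [e i] times a unit vector. The last bound sums a lower
    estimate of [Q i j] over all pairs; the bound 4 comes from 10 * 4 = 40. *)
Lemma sign_rows r : P <= 240 -> \sum_i Q i r <= 40 ->
  (forall i, Q i r = 0 \/ Q i r = 10) ->
  exists e : 'I_6 -> int,
  [/\ forall i, [\/ e i = 0, e i = 1 | e i = -1],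
      forall i, exists u k, forall l, N i l = N r l + u + e i * (l == k)%:R,
      \sum_i e i ^+ 2 <= 4 &
      120 * (\sum_i e i ^+ 2) - 12 * (\sum_i e i ^+ 2) ^+ 2
        - 8 * (\sum_i e i) ^+ 2 <= P].
Proof.
move=> P240 R40 R10.
have ex i : exists e : int, [/\ [\/ e = 0, e = 1 | e = -1],
    exists u k, forall l, N i l = N r l + u + e * (l == k)%:R & Q i r = 10 * e ^+ 2].
  have : Q i r <= 24 by case: (R10 i) => ->.
  case/spread_small=> t; rewrite -/(Q i r); have := R10 i.
  move=> R1; case=> [[e1 dE]|[e1 [e [k [ee dE]]]]|[[e1 _]|[e1 _]]|[e1 _]];
    try by move: R1; rewrite e1; case.
    exists 0; split; [by constructor 1| | by rewrite e1].
    by exists t, ord0 => l; rewrite mul0r -(dE l); lia.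
  exists e; split; [| |by rewrite e1; case: ee => ->].
    by case: ee => ->; [constructor 2 | constructor 3].
  by exists t, k => l; have := dE l; lia.
have [e /all_and3[e01 eN eR]] := fin_all_exists ex; exists e; split=> //.
  by move: R40; under eq_bigr do rewrite eR; rewrite -mulr_sumr; lia.
have le i j :
    10 * (e i ^+ 2 + e j ^+ 2) - 12 * (e i ^+ 2 * e j ^+ 2) - 8 * (e i * e j) <= Q i j.
  have ge0 := row_spread_ge0 i j; have [u [k iE]] := eN i; have [u' [k' jE]] := eN j.
  have Ri := eR i; have Rj := eR j; have sgn := row_spread_sign iE jE.
  have i0 : Q i r = 0 -> Q i j = Q j r by move=> /row_spread_trans->; rewrite row_spreadC.
  have j0 : Q j r = 0 -> Q i j = Q i r.
    by move=> jr; rewrite row_spreadC (row_spread_trans _ jr) row_spreadC.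
  (* The quadratic form is 0, 10, 16 for signs that are equal, of which one is
     zero, opposite, respectively. *)
  have cases (a b x y q : int) : [\/ a = 0, a = 1 | a = -1] -> [\/ b = 0, b = 1 | b = -1] ->
      0 <= q -> x = 10 * a ^+ 2 -> y = 10 * b ^+ 2 -> (x = 0 -> q = y) -> (y = 0 -> q = x) ->
      (a = 1 /\ b = -1 \/ a = -1 /\ b = 1 -> 16 <= q) ->
      10 * (a ^+ 2 + b ^+ 2) - 12 * (a ^+ 2 * b ^+ 2) - 8 * (a * b) <= q.
    by case=> -> [] ->; rewrite ?sqrrN ?expr1n ?expr0n /=; lia.
  exact: cases (e01 i) (e01 j) ge0 Ri Rj i0 j0 sgn.
apply: le_trans (ler_sum _ (fun i _ => ler_sum _ (fun j _ => le i j))).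
set m := \sum_i e i ^+ 2; set s := \sum_i e i.
have -> : \sum_i \sum_j (10 * (e i ^+ 2 + e j ^+ 2)
      - 12 * (e i ^+ 2 * e j ^+ 2) - 8 * (e i * e j))
   = \sum_i (60 * e i ^+ 2 + 10 * m - 12 * m * e i ^+ 2 - 8 * s * e i).
  apply: eq_bigr => i _; rewrite !sumrB -!mulr_sumr big_split sumr_const card_ord /= -/m -/s.
  by rewrite -mulr_natl; ring.
rewrite !sumrB big_split -!mulr_sumr sumr_const card_ord /= -/m -/s -mulr_natl.
by rewrite !expr2; lia.
Qed.

(** Row [x] has spread at least 16 from row [r] and each row in [K] at least 10, so the bound 40
    leaves at most two rows in [K]. *)
Lemma long_row r x : P <= 240 -> \sum_i Q i r <= 40 -> Q x r != 0 -> Q x r != 10 ->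
  160 <= P /\
  ((forall i, i != x -> Q i r = 0) /\ P = 10 * Q x r \/
   exists t, \sum_i \sum_l N i l = 2 * t + 1).
Proof.
move=> P240 R40 x0 x10; have x16 : 16 <= Q x r.
  by case: (row_spread_values x r) x0 x10 => [->|->|->|]; rewrite ?eqxx //; lia.
pose K : {set 'I_6} := [set i | (i != x) && (Q i r != 0)].
have xK : x \notin K by rewrite inE eqxx.
have out i : i \notin x |: K -> Q i r = 0.
  by rewrite !inE negb_or => /andP[ix]; rewrite ix /= negbK => /eqP.
have Psplit := total_spread_split out.
have sumR : \sum_(i in x |: K) Q i r <= 40.
  by move: R40; rewrite (bigID [in x |: K]) /= [X in _ + X <= _]big1 ?addr0.
have K10 y : y \in K -> 10 <= Q y r by rewrite inE => /andP[_ /row_spread_ge10].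
have Qxx y : Q y y = 0.
  by apply: big1 => k _; apply: big1 => l _; rewrite !subrr expr0n.
have neQ y : Q y r != Q x r -> 10 <= Q x y.
  by move=> yx; apply: row_spread_ge10; apply: contraNneq yx => /row_spread_trans->.
have K2 : (#|K| <= 2)%N.
  have : 10 * #|K|%:Z <= \sum_(i in K) Q i r.
    rewrite mulrC -[Posz _]natz mulr_natl -sumr_const; apply: ler_sum => i; apply: K10.
  have arith (p : nat) (q q' : int) :
    16 <= q -> q + q' <= 40 -> 10 * p%:Z <= q' -> (p <= 2)%N by lia.
  by move: sumR; rewrite big_setU1 //=; apply: arith.
have cardD : #|x |: K| = #|K|.+1 by rewrite cardsU1 xK.
move: Psplit sumR; rewrite cardD !big_setU1 //=.
have [K0|[K1|K2']] : #|K| = 0%N \/ #|K| = 1%N \/ #|K| = 2%N by lia.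
- rewrite K0 (cards0_eq K0) !big_set0 Qxx !addr0 => Psplit _.
  split; first by rewrite Psplit; lia.
  left; split; last by rewrite Psplit; lia.
  by move=> i ix; apply: out; rewrite (cards0_eq K0) setU0 inE.
(* Now P = 8 (Q x r + Q y r) + 2 Q x y <= 240 forces Q x r = 16 and Q y r = 10. Relative to row [r],
   only row [y] then has an odd sum. *)
- have /eqP/cards1P[y Ky] := K1; have yK : y \in K by rewrite Ky set11.
  have yx : x != y by apply: contraNneq xK => ->.
  rewrite K1 Ky !big_set1 big_setU1 ?inE //= !big_set1 !Qxx (row_spreadC y x) !add0r !addr0.
  move=> Psplit sumR.
  have y10 := K10 _ yK; split; first by have := row_spread_ge0 x y; rewrite Psplit; lia.
  right; have xy10 : 10 <= Q x y.
    apply: neQ; apply/eqP=> eq_yx; move: P240; rewrite Psplit eq_yx.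
    by have := row_spread_ge0 x y; lia.
  rewrite Psplit in P240.
  have x_16 : Q x r = 16 by have := row_spread_values x r; case; lia.
  have y_10 : Q y r = 10 by have := row_spread_values y r; case; lia.
  have odd2 (i : 'I_6) : exists t, \sum_l (N i l - N r l) = 2 * t + (i == y)%:R.
    have [->|iy] := eqVneq i y.
      have : spread (fun l => N y l - N r l) <= 24 by rewrite -/(Q y r) y_10.
      case/spread_small=> t; rewrite -/(Q y r) y_10.
      case=> [[//]|[_ [e [k [ee dE]]]]|[[//]|[//]]|[//]].
      under eq_bigr do rewrite dE.
      rewrite big_split sumr_const card_ord -mulr_sumr sum_delta /=.
      by rewrite -[t *+ _]mulr_natl; case: ee => ->; [exists (3 * t) | exists (3 * t - 1)]; lia.
    have [->|ix] := eqVneq i x.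
      have : spread (fun l => N x l - N r l) <= 24 by rewrite -/(Q x r) x_16.
      case/spread_small=> t; rewrite -/(Q x r) x_16.
      case=> [[//]|[//]|[[_ [e [ee ->]]]|[//]]|[//]].
      by case: ee => ->; [exists (3 * t + 1) | exists (3 * t - 1)]; lia.
    have /out/row_spread_eq0[t tE] : i \notin x |: K by rewrite Ky !inE negb_or ix.
    exists (3 * t); rewrite (eq_bigr (fun=> t)); last by move=> l _; rewrite tE; lia.
    by rewrite sumr_const card_ord -mulr_natl addr0; lia.
  have [g gE] := fin_all_exists odd2.
  by have [t ->] := sum_rows_mod (erefl : 2 * 3 = 6 :> int) gE; exists t; rewrite sum_delta.
(* Impossible: P is at least 6 * 36 + 2 * (10 + 10) = 256. *)
- have /eqP/cards2P[y [z [yz KE]]] := K2'.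
  have yK : y \in K by rewrite KE; apply/set2P; left.
  have zK : z \in K by rewrite KE; apply/set2P; right.
  have xyz : x \notin [set y; z] by rewrite -KE.
  have {}yz : y \notin [set z] by rewrite inE.
  have big_xyz F : \sum_(i in x |: [set y; z]) F i = F x + (F y + F z) :> int.
    by rewrite big_setU1 //= big_setU1 //= big_set1.
  have big_yz F : \sum_(i in [set y; z]) F i = F y + F z :> int.
    by rewrite big_setU1 //= big_set1.
  rewrite K2' KE !big_yz !big_xyz !Qxx => Psplit sumR.
  have y10 := K10 _ yK; have z10 := K10 _ zK.
  have xy : 10 <= Q x y by apply: neQ; apply/eqP; lia.
  have xz : 10 <= Q x z by apply: neQ; apply/eqP; lia.
  rewrite (row_spreadC y x) (row_spreadC z x) (row_spreadC z y) in Psplit.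
  have := row_spread_ge0 y z; rewrite Psplit in P240; lia.
Qed.

End Rows.

(** * From integral expansions of small norm to the 42 codes *)

Section Codes6.
Local Open Scope ring_scope.
Implicit Types (w : 'S_6) (a b i j k l r x y : 'I_6) (X Y : 'I_6 + 'I_6 * 'I_6).

Definition code6 X : {set 'S_6} :=
  match X with
  | inl a => value_code a
  | inr (i, k) => [set w | outer w i == k]
  end.

Lemma sum_const6 (t : int) : \sum_(i < 6) t = 6 * t.
Proof. by rewrite sumr_const card_ord -[LHS]mulr_natl. Qed.

Lemma sum_outer w (F : 'I_6 -> int) : \sum_i F (outer w i) = \sum_i F i.
Proof. by rewrite [RHS](reindex_inj (@perm_inj _ (outer w))). Qed.

(** Lets a constant function be written in the common form, with X = Y. *)
Lemma code6_const : exists X Y, forall w, (w \in code6 X)%:R - (w \in code6 Y)%:R = 0 :> int.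
Proof. by exists (inl ord0), (inl ord0) => w; rewrite subrr. Qed.

(** For use with [m] and [s] the sums of the squared signs and of the signs of [sign_rows], [p] the
    total spread of N, [q] the spread of c and [e] the sum of c modulo 6. Only finitely many pairs
    (m, s) occur. *)
Lemma sign_arith (m s p q t e v : int) :
  0 <= m -> m <= 4 -> s <= m -> - s <= m -> m = s + 2 * v ->
  120 * m - 12 * m ^+ 2 - 8 * s ^+ 2 <= p -> 10 * q + p <= 240 ->
  6 * t + e + s = 0 ->
  (q = 0 /\ e = 0 -> m = 0 \/ m = 2 /\ s = 0) /\
  (q = 10 /\ (e = 1 \/ e = -1) -> m = 1 /\ s = - e) /\
  (q = 16 -> ~ (e = 2 \/ e = -2)) /\
  (q = 18 -> e <> 3) /\ (q = 24 /\ e = 0 -> m = 0).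
Proof.
move=> m0 m4 sm ms mv; rewrite !expr2.
have [m1|[m1|[m1|[m1|m1]]]] : m = 0 \/ m = 1 \/ m = 2 \/ m = 3 \/ m = 4 by lia.
all: have [s1|[s1|[s1|[s1|[s1|[s1|[s1|[s1|s1]]]]]]]] : s = 0 \/ s = 1 \/ s = 2 \/ s = 3 \/
    s = 4 \/ s = -1 \/ s = -2 \/ s = -3 \/ s = -4 by lia.
all: rewrite m1 s1 in sm ms mv *; lia.
Qed.

(** If all rows of N have spread 0 or 10 from row r, N contributes signed D_ik and c contributes
    signed C_a; [sign_arith] leaves at most one code of each sign. Otherwise one long row carries
    everything and is, up to constants, a difference of two unit vectors. *)
Lemma integer_codes (c : 'I_6 -> int) (N : 'I_6 -> 'I_6 -> int) (t0 : int) :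
  10 * spread c + total_spread N <= 240 ->
  6 * t0 + \sum_a c a + \sum_i \sum_k N i k = 0 ->
  exists t X Y, forall w,
    c (w ord0) + \sum_i N i (outer w i) = t + (w \in code6 X)%:R - (w \in code6 Y)%:R.
Proof.
move=> norm mod6; have c0 := spread_ge0 c.
have P240 : total_spread N <= 240 by lia.
have [r R40] := short_row P240.
have P0 : 0 <= total_spread N.
  by apply: sumr_ge0 => i _; apply: sumr_ge0 => j _; apply: spread_ge0.
(* As [outer w] is a permutation, row [r] may be subtracted from every row at the cost of a
   constant. *)
have F w : \sum_i N i (outer w i) =
    \sum_i N r i + \sum_i (N i (outer w i) - N r (outer w i)).
  by rewrite sumrB sum_outer; ring.
have c24 : spread c <= 24 by lia.
have [/forallP R10|] := boolP [forall i, (row_spread N i r == 0) || (row_spread N i r == 10)].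
  have {}R10 i : row_spread N i r = 0 \/ row_spread N i r = 10.
    by case/orP: (R10 i) => /eqP; [left | right].
  have [e [e01 /fin_all_exists[u] /fin_all_exists[k Ne] m4 mP]] := sign_rows P240 R40 R10.
  have m0 : 0 <= \sum_i e i ^+ 2 by apply: sumr_ge0 => i _; apply: sqr_ge0.
  have sm : \sum_i e i <= \sum_i e i ^+ 2.
    by apply: ler_sum => i _; case: (e01 i) => ->.
  have ms : - \sum_i e i <= \sum_i e i ^+ 2.
    by rewrite -sumrN; apply: ler_sum => i _; case: (e01 i) => ->.
  have [v mv] : exists v, \sum_i e i ^+ 2 = \sum_i e i + 2 * v.
    have /fin_all_exists[v vE] i : exists v, e i ^+ 2 = e i + 2 * v.
      by case: (e01 i) => ->; [exists 0 | exists 0 | exists 1]; rewrite ?sqrrN ?expr1n ?expr0n.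
    by exists (\sum_i v i); rewrite mulr_sumr -big_split; apply: eq_bigr => i _ /=.
  have row i : \sum_l (N i l - N r l) = 6 * u i + e i.
    rewrite (eq_bigr (fun l => u i + e i * (l == k i)%:R)); last by move=> l _; rewrite Ne; ring.
    by rewrite big_split /= -mulr_sumr sum_delta sum_const6 mulr1.
  have [t1 sumN] := sum_rows_mod (erefl : 6 * 1 = 6 :> int) row.
  have [C FE] : exists C, forall w, \sum_i N i (outer w i) =
      C + \sum_i e i * (w \in code6 (inr (i, k i)))%:R.
    exists (\sum_i N r i + \sum_i u i) => w; rewrite F -addrA.
    congr (_ + _); rewrite -big_split; apply: eq_bigr => i _ /=.
    by rewrite Ne inE; ring.
  have [t cE] := spread_small c24.
  have sumE (d : int) : \sum_a c a = 6 * t + d -> 6 * (t0 + t + t1) + d + \sum_i e i = 0.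
    by move=> sc; move: mod6; rewrite sc sumN; move: (\sum_i e i) => s; lia.
  have ar d sc := sign_arith m0 m4 sm ms mv mP norm (sumE d sc).
  have sumc (d : 'I_6 -> int) : (forall l, c l = t + d l) -> \sum_a c a = 6 * t + \sum_a d a.
    by move=> cd; under eq_bigr do rewrite cd; rewrite big_split sum_const6.
  have e0 : \sum_i e i ^+ 2 = 0 -> forall i, e i = 0.
    move=> m00 i; have /eqP : e i ^+ 2 = 0.
      by apply: (psumr_eq0P _ m00) => // j _; apply: sqr_ge0.
    by rewrite sqrf_eq0 => /eqP.
  case: cE => [[q0 cE]|[q10 [s [a [s1 cE]]]]|[[q16 [d [d2 sc]]]|[q18 sc]]|[q24 [a [b [ab cE]]]]].
  - have sc : \sum_a c a = 6 * t + 0.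
      by rewrite (sumc (fun=> 0)) => [|l]; rewrite ?big1 // cE addr0.
    have [+ _] := ar _ sc; case=> // [m00|[m2 s0]].
      have [X [Y XY]] := code6_const; exists (t + C), X, Y => w.
      rewrite FE big1 => [|i _]; last by rewrite (e0 m00) mul0r.
      by rewrite cE -addrA XY !addr0.
    have [x [y [xy eE]]] := sum_sqr_eq2 m2 s0.
    exists (t + C), (inr (x, k x)), (inr (y, k y)) => w.
    rewrite FE cE; under eq_bigr do rewrite eE mulrBl.
    rewrite sumrB (bigD1 x) //= eqxx mul1r big1 => [|i /negPf->]; last by rewrite mul0r.
    rewrite (bigD1 y) //= eqxx mul1r big1 => [|i /negPf->]; last by rewrite mul0r.
    by ring.
  - have sc : \sum_a c a = 6 * t + s.
      by rewrite (sumc (fun l => s * (l == a)%:R)) // -mulr_sumr sum_delta mulr1.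
    have [_ [+ _]] := ar _ sc; case=> // m1 sE.
    have [x [_ _ ex]] := sum_sqr_eq1 m1.
    have {}sE : e x = - s by rewrite -sE (bigD1 x) //= big1 ?addr0 // => i; apply: ex.
    have FE' w : c (w ord0) + \sum_i N i (outer w i) =
        t + C + s * ((w \in code6 (inl a))%:R - (w \in code6 (inr (x, k x)))%:R).
      rewrite FE cE (bigD1 x) //= sE big1 => [|i ix]; last by rewrite ex ?mul0r.
      by rewrite !inE; ring.
    case: s1 FE' => -> FE'.
      by exists (t + C), (inl a), (inr (x, k x)) => w; rewrite FE'; ring.
    by exists (t + C), (inr (x, k x)), (inl a) => w; rewrite FE'; ring.
  - by have [_ [_ [+ _]]] := ar _ sc; case.
  - by have [_ [_ [_ [+ _]]]] := ar _ sc; case.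
  - have sc : \sum_a c a = 6 * t + 0.
      rewrite (sumc (fun l => (l == a)%:R - (l == b)%:R)) ?sumrB ?sum_delta //.
      by move=> l; rewrite cE addrA.
    have [_ [_ [_ [_ +]]]] := ar _ sc; move=> /(_ (conj q24 erefl)) m00.
    exists (t + C), (inl a), (inl b) => w.
    rewrite FE cE big1 => [|i _]; last by rewrite (e0 m00) mul0r.
    by rewrite !inE; ring.
rewrite negb_forall => /existsP[x]; rewrite negb_or => /andP[x0 x10].
have [P160 long] := long_row P240 R40 x0 x10.
have [t cE] := spread_small c24.
(* The long row uses up 160 of 240, so 10 * spread c <= 80 and c is constant. *)
case: cE => [[_ cE]|[q10 _]|[[q16 _]|[q18 _]]|[q24 _]]; try by exfalso; lia.
have sc : \sum_a c a = 6 * t.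
  by under eq_bigr do rewrite cE; rewrite sum_const6.
case: long => [[rows Px]|[t1 sumN]]; last first.
  by exfalso; move: mod6; rewrite sc sumN; lia.
have x24 : row_spread N x r <= 24 by lia.
have [u uE] : exists u : 'I_6 -> int, forall i, i != x -> forall l, N i l = N r l + u i.
  apply: (@fin_all_exists _ _ (fun i v => i != x -> forall l, N i l = N r l + v)) => i.
  by have [->|/rows/row_spread_eq0[v vE]] := eqVneq i x; [exists 0 | exists v].
(* Only row [x] matters modulo 6, so its sum relative to row [r] is 0 modulo 6; this excludes the
   spreads 16 and 18. *)
have mod_x d t1 : \sum_l (N x l - N r l) = 6 * t1 + d -> exists t2, 6 * t2 + d = 0.
  move=> dE; have row i : \sum_l (N i l - N r l) =
      6 * (if i == x then t1 else u i) + d * (i == x)%:R.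
    have [->|ix] := eqVneq i x; first by rewrite dE mulr1.
    rewrite (eq_bigr (fun=> u i)) => [|l _]; last by rewrite uE //; ring.
    by rewrite sum_const6 mulr0 addr0.
  have [t2] := sum_rows_mod (erefl : 6 * 1 = 6 :> int) row.
  rewrite -mulr_sumr sum_delta => sumN; exists (t0 + t + t2).
  by move: mod6; rewrite sc sumN; lia.
have [t1 xE] := spread_small x24; rewrite -/(row_spread N x r) in xE.
case: xE => [[xq _]|[xq _]|[[_ [d [d2 /mod_x[t2 te]]]]|[_ /mod_x[t2 te]]]|[_ [k [k' [kk' xE]]]]].
- by rewrite xq eqxx in x0.
- by rewrite xq eqxx in x10.
- by exfalso; lia.
- by exfalso; lia.
exists (t + (\sum_i N r i + (t1 + \sum_(i | i != x) u i))), (inr (x, k)), (inr (x, k')) => w.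
rewrite cE F; set A := \sum_i N r i.
rewrite (bigD1 x) //= xE (eq_bigr u) => [|i ix]; last by rewrite uE //; ring.
by rewrite !inE; ring.
Qed.

End Codes6.

(** * Bitrades in the Star graph of Sym_6 *)

Section Bitrades6.
Implicit Types (v w z : 'S_6) (a b i j k l : 'I_6) (X Y : 'I_6 + 'I_6 * 'I_6).
Implicit Types T : {set 'S_6}.
Local Notation E := (@star_graph 6).
Local Open Scope ring_scope.

Lemma exact_code6 X : exact_code E (code6 X).
Proof.
case: X => [a|[i k]]; first exact: exact_value_code.
by apply: (@exact_code_star 5 (fun w => outer w i)) => x j j' /=;
  rewrite !outerM !permM => /perm_inj/outer_star_inj.
Qed.

Lemma card_code6 X : #|code6 X| = 120%N.
Proof. exact/(@card_exact_code_star 5)/exact_code6. Qed.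

Lemma spread_scale (d g : 'I_6 -> int) (p t : int) :
  (forall k, d k = p * g k + t) -> spread d = p ^+ 2 * spread g.
Proof.
move=> dE; rewrite /spread mulr_sumr; apply: eq_bigr => k _.
by rewrite mulr_sumr; apply: eq_bigr => l _; rewrite !dE; ring.
Qed.

Lemma sum_code6 (h : 'S_6 -> 'I_6) (F : 'I_6 -> int) :
  (forall a, #|[set w | h w == a]| = 120%N) ->
  \sum_w F (h w) = 120 * \sum_a F a.
Proof.
move=> h120; have := sum_fibers h (fun=> 1) F.
under eq_bigr do rewrite mul1r; move=> ->; rewrite mulr_sumr; apply: eq_bigr => a _.
by rewrite sumr_const -(h120 a) cardsE mulrC.
Qed.

Section FromKernel.
Variable f : 'S_6 -> int.
Hypotheses (fK : star_ker f) (f240 : \sum_w f w ^+ 2 <= 240).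
Local Notation s := (value_sum f).
Local Notation S := (total_sum f).

Lemma kernel_codes :
  exists X Y, forall w, f w = (w \in code6 X)%:R - (w \in code6 Y)%:R.
Proof.
have /fin_all_exists[c cE] a := value_sum_mod fK a ord0.
have /fin_all_exists[N NE] i : exists Ni : 'I_6 -> int,
    forall k, S i k + S ord0 ord0 - S i ord0 - S ord0 k = 144 * Ni k.
  exact: fin_all_exists (fun k => total_sum_mod fK i ord0 k ord0).
(* As the sums [s a] add up to 0, 12 times the left side is [spread s], which is 120^2 * spread
   c. *)
have normc : \sum_a s a ^+ 2 = 1200 * spread c.
  have := spread_scale (d := s) (g := c) (p := 120) (t := s ord0).
  rewrite spreadE sum_value_sum // expr0n mulr0 subr0 => sc.
  have {}sc := sc (fun k => _); move: sc; set A := \sum_a _; set B := spread c => sc.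
  suff : 12 * A = 120 ^+ 2 * B by lia.
  by apply: sc => k; have := cE k; lia.
have normN : \sum_i \sum_k S i k ^+ 2 = 144 * total_spread N.
  have : \sum_i \sum_j spread (fun l => S i l - S j l) = 144 ^+ 2 * total_spread N.
    rewrite /total_spread mulr_sumr; apply: eq_bigr => i _.
    rewrite mulr_sumr; apply: eq_bigr => j _.
    apply: (spread_scale (t := S i ord0 - S j ord0)) => l.
    by have := NE i l; have := NE j l; lia.
  (* Rows and columns of S both sum to 0, so [spreadE] yields a factor 12 in each direction. *)
  have -> : \sum_i \sum_j spread (fun l => S i l - S j l) = 144 * \sum_i \sum_k S i k ^+ 2.
    transitivity (\sum_i \sum_j \sum_l 12 * (S i l - S j l) ^+ 2).
      apply: eq_bigr => i _; apply: eq_bigr => j _.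
      by rewrite spreadE sumrB !sum_total_sumr // subrr expr0n mulr0 subr0 mulr_sumr.
    under eq_bigr do rewrite exchange_big.
    rewrite exchange_big [in RHS]exchange_big mulr_sumr /=; apply: eq_bigr => l _.
    have Sl : spread (fun i => S i l) = 12 * \sum_i S i l ^+ 2.
      by rewrite spreadE sum_total_suml // expr0n mulr0 subr0.
    transitivity (12 * \sum_i \sum_j (S i l - S j l) ^+ 2).
      by rewrite mulr_sumr; apply: eq_bigr => i _; rewrite mulr_sumr.
    by rewrite [\sum_i _]Sl mulrA.
  by move: (\sum_i \sum_k _) (total_spread N) => A B; lia.
have norm : 10 * spread c + total_spread N <= 240.
  have := norm_expansion fK; rewrite normc normN; move: f240.
  by move: (\sum_w _) (spread c) (total_spread N) => A B C; lia.
have fE w : 720 * f w =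
    720 * (c (w ord0) + \sum_i N i (outer w i)) + (6 * s ord0 - 30 * S ord0 ord0).
  rewrite (expansion fK).
  have -> : \sum_i S i (outer w i) = 144 * \sum_i N i (outer w i) - 6 * S ord0 ord0.
    rewrite (eq_bigr (fun i => 144 * N i (outer w i) - S ord0 ord0 + S i ord0
                               + S ord0 (outer w i))).
      rewrite !big_split /= -mulr_sumr (sum_outer w) sum_total_sumr // sum_total_suml //.
      by rewrite sum_const6; ring.
    by move=> i _; have := NE i (outer w i); lia.
  by have := cE (w ord0); lia.
(* Reading the constant off at the identity shows that it is an integer. *)
have [t1 fE1] : exists t1, forall w, f w = c (w ord0) + \sum_i N i (outer w i) + t1.
  exists (f 1%g - (c ((1%g : 'S_6) ord0) + \sum_i N i (outer 1%g i))) => w.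
  have := fE w; have := fE 1%g.
  by move: (\sum_i N i (outer w i)) (\sum_i N i (outer 1 i)) => A B; lia.
have sumN : \sum_w \sum_i N i (outer w i) = 120 * \sum_i \sum_k N i k.
  rewrite exchange_big mulr_sumr; apply: eq_bigr => i _.
  by apply: (sum_code6 (h := fun w => outer w i) (N i)) => k; exact: (card_code6 (inr (i, k))).
have mod6 : 6 * t1 + \sum_a c a + \sum_i \sum_k N i k = 0.
  have := star_ker_sum0 fK; rewrite (eq_bigr _ (fun w _ => fE1 w)) !big_split /=.
  rewrite (sum_code6 (h := fun w : 'S_6 => w ord0)) => [|a]; last exact: (card_code6 (inl a)).
  rewrite sumN sumr_const card_Sn -[t1 *+ _]mulr_natl.
  have arith (A B : int) : 120 * A + 120 * B + 720 * t1 = 0 -> 6 * t1 + A + B = 0 by lia.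
  exact: arith.
have [t [X [Y XY]]] := integer_codes norm mod6; exists X, Y.
have fXY w : f w = t + t1 + ((w \in code6 X)%:R - (w \in code6 Y)%:R) by rewrite fE1 XY; ring.
(* The codes X and Y have equal size and f sums to 0, so the constant vanishes. *)
suff tt1 : t + t1 = 0 by move=> w; rewrite fXY tt1 add0r.
have := star_ker_sum0 fK; rewrite (eq_bigr _ (fun w _ => fXY w)) big_split sumrB /=.
rewrite -!natr_sum -!big_mkcond !sum1_card /= !card_code6 subrr addr0.
by rewrite sumr_const card_Sn -[_ *+ 6`!]mulr_natl => /eqP; rewrite mulf_eq0 => /orP[//|/eqP].
Qed.

End FromKernel.

(** The sum is |T0| + |T1|. Each of the 720 balls meets each set at most once and every vertex lies
    in 6 balls, so both sets have size at most 120. *)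
Lemma bitrade_fun_norm T0 T1 : perfect_bitrade E T0 T1 ->
  \sum_w bitrade_fun T0 T1 w ^+ 2 <= 240.
Proof.
case=> _ dis bal; have sum_card T : (\sum_w (w \in T)%:R = #|T|%:Z :> int).
  by rewrite -natr_sum -big_mkcond sum1_card natz.
have -> : \sum_w bitrade_fun T0 T1 w ^+ 2 = #|T0|%:Z + #|T1|%:Z.
  rewrite -!sum_card -big_split; apply: eq_bigr => w _ /=; rewrite /bitrade_fun.
  case: (boolP (w \in T0)) => [/(disjointFr dis)->//|_].
  by case: (w \in T1).
have card6 := sum_card_nbhd _ (@star_graph_sym 5) (@card_closed_nbhd_star 5).
have := card6 T0; have := card6 T1.
have : (\sum_x #|closed_nbhd E x :&: T0| <= \sum_(x : 'S_6) 1)%N.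
  by apply: leq_sum => x _; case: (bal x).
have -> : (\sum_x #|closed_nbhd E x :&: T1| = \sum_x #|closed_nbhd E x :&: T0|)%N.
  by apply: eq_bigr => x _; case: (bal x).
have arith (m p q : nat) :
  (m <= 720)%N -> m = (q * 6)%N -> m = (p * 6)%N -> p%:Z + q%:Z <= 240 by lia.
by rewrite sum1_card card_Sn; apply: arith.
Qed.

Lemma bitrade6_codes T0 T1 : perfect_bitrade E T0 T1 ->
  exists X Y, T0 = code6 X :\: code6 Y /\ T1 = code6 Y :\: code6 X.
Proof.
move=> bt; have [_ dis _] := bt.
have [X [Y XY]] := kernel_codes (bitrade_fun_ker bt) (bitrade_fun_norm bt).
by exists X, Y; apply: bitrade_fun_codes.
Qed.


Lemma card_codeD X Y : #|code6 X :\: code6 Y| = (120 - #|code6 X :&: code6 Y|)%N.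
Proof. by rewrite cardsD card_code6. Qed.

Lemma card_value_codeI a b : a != b -> #|code6 (inl a) :&: code6 (inl b)| = 0%N.
Proof.
move=> ab; apply: eq_card0 => w; rewrite !inE.
by apply: contraNF ab => /andP[/eqP<- /eqP<-].
Qed.

(** Right multiplication by a [z] with [outer z] a transposition of values other than [k] shows that
    the five sets [A m] with m != k, which partition D_ik, have equal size 120 / 5. *)
Lemma card_total_codeI i j k l : i != j -> k != l ->
  #|code6 (inr (i, k)) :&: code6 (inr (j, l))| = 24%N.
Proof.
move=> ij kl; pose A m := code6 (inr (i, k)) :&: code6 (inr (j, m)).
have cardA m : m != k -> #|A m| = #|A l|.
  move=> mk; have lk : l != k by rewrite eq_sym.
  have [z zE] := outer_surj (tperm m l).
  rewrite -(card_imset _ (mulIg z)); apply: eq_card => w; rewrite -[w](mulgKV z).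
  move: (w * z^-1)%g => u; rewrite (mem_imset _ _ (mulIg z)) !inE outerM zE !permM.
  rewrite -(inj_eq (@perm_inj _ (tperm m l)) (outer u i)) (@tpermD _ m l k) //.
  by rewrite -(inj_eq (@perm_inj _ (tperm m l)) (outer u j)) tpermL.
have Ak : #|A k| = 0%N.
  apply: eq_card0 => w; rewrite !inE.
  by apply: contraNF ij => /andP[/eqP<- /eqP/perm_inj->].
have : (\sum_m #|A m| = 120)%N.
  rewrite -(card_code6 (inr (i, k))) -[RHS]sum1_card.
  rewrite (partition_big (fun w => outer w j) xpredT) //=; apply: eq_bigr => m _.
  by rewrite -sum1_card; apply: eq_bigl => w; rewrite !inE.
rewrite (bigD1 k) //= Ak add0n (eq_bigr (fun=> #|A l|)) => [|m /cardA//].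
by rewrite sum_nat_const cardC1 card_ord -/(A l); move: #|A l| => m; lia.
Qed.

(** The exotic transitive action of Sym_5, the stabilizer of 0, on the six totals; checked by
    computation. *)
Lemma value_stabilizer_transitive i j :
  exists z, z ord0 = ord0 /\ outer z i = j.
Proof.
have : all (fun m => all (fun m' =>
    has (fun s => eqn (nth 0%N s 0) 0 && eqn (tot_nat s m) m') (words 6)) (iota 0 6)) (iota 0 6).
  by vm_compute.
move=> /all_iota_ord/(_ i)/all_iota_ord/(_ j)/hasP[s /words_word[z <-]].
rewrite nth_word0 -val_tot => /andP[/eqnP z0 /eqnP zi].
by exists z; split; apply: val_inj; rewrite //= outerE.
Qed.

(** The six sets [A j] partition C_a, and left multiplication by elements fixing 0 shows that they
    have equal size 120 / 6. *)
Lemma card_value_total_codeI a i k : #|code6 (inl a) :&: code6 (inr (i, k))| = 20%N.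
Proof.
pose A j := code6 (inl a) :&: code6 (inr (j, k)).
have cardA j : #|A j| = #|A i|.
  have [z [z0 zj]] := value_stabilizer_transitive i j.
  rewrite -(card_imset _ (mulgI z)); apply: eq_card => w; rewrite -[w](mulKVg z).
  move: (z^-1 * w)%g => u; by rewrite (mem_imset _ _ (mulgI z)) !inE outerM !permM z0 zj.
have : (\sum_j #|A j| = 120)%N.
  rewrite -(card_code6 (inl a)) -[RHS]sum1_card.
  under eq_bigr do rewrite -sum1_card big_mkcond.
  rewrite exchange_big [RHS]big_mkcond; apply: eq_bigr => w _ /=.
  rewrite (reindex_inj (@perm_inj _ (outer w)^-1%g)) (bigD1 k) //= !inE permKV eqxx andbT.
  rewrite big1 ?addn0 // => j /negPf jk; rewrite !inE permKV jk andbF //.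
by rewrite (eq_bigr (fun=> #|A i|)) // sum_nat_const card_ord -/(A i); move: #|A i| => m; lia.
Qed.

Lemma card_codeI X Y : X != Y ->
  #|code6 X :&: code6 Y| \in [:: 0; 20; 24]%N.
Proof.
case: X Y => [a|[i k]] [b|[j l]] XY; last first.
- have [ij|ij] := eqVneq i j; last have [kl|kl] := eqVneq k l.
  + have kl : k != l by apply: contraNneq XY => ->; rewrite ij.
    rewrite (_ : _ :&: _ = set0) ?cards0 //; apply/setP=> w; rewrite !inE ij.
    by apply: contraNF kl => /andP[/eqP<- /eqP<-].
  + rewrite (_ : _ :&: _ = set0) ?cards0 //; apply/setP=> w; rewrite !inE kl.
    by apply: contraNF ij => /andP[/eqP<- /eqP/perm_inj->].
  + by rewrite card_total_codeI.
- by rewrite setIC card_value_total_codeI.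
- by rewrite card_value_total_codeI.
- by rewrite card_value_codeI.
Qed.

Lemma bitrade6_volume T0 T1 : perfect_bitrade E T0 T1 ->
  embeddable E T0 T1 /\ #|T0| \in [:: 120; 100; 96]%N.
Proof.
move=> bt; have [X [Y [T0E T1E]]] := bitrade6_codes bt; split.
  exists (code6 X), (code6 Y); rewrite -T0E -T1E.
  by split=> //; apply: (@perfect_code_star 5) => //; apply: exact_code6.
have XY : X != Y by case: bt => neq _ _; apply: contraNneq neq => XY; rewrite T0E T1E XY.
by have := card_codeI XY; rewrite T0E card_codeD !inE => /or3P[]/eqP->.
Qed.

Lemma code6_bitrade X Y (m : nat) : (0 < m)%N -> #|code6 X :\: code6 Y| = m ->
  exists T0 T1, perfect_bitrade E T0 T1 /\ #|T0| = m.
Proof.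
move=> m0 XYm; exists (code6 X :\: code6 Y), (code6 Y :\: code6 X); split=> //.
apply: exact_code_bitrade; try exact: exact_code6.
by apply/eqP=> XY; move: m0; rewrite -XYm XY setDv cards0.
Qed.

End Bitrades6.

Theorem proposition3 :
  (forall n : nat, 3 <= n <= 6 ->
     forall T0 T1 : {set 'S_n},
       perfect_bitrade (@star_graph n) T0 T1 ->
       embeddable (@star_graph n) T0 T1) /\
  (forall n : nat, n \in [:: 3; 4; 5] ->
     forall T0 T1 : {set 'S_n},
       perfect_bitrade (@star_graph n) T0 T1 -> #|T0| = (n - 1)`!) /\
  (forall v : nat,
     (exists T0 T1 : {set 'S_6},
        perfect_bitrade (@star_graph 6) T0 T1 /\ #|T0| = v) <->
     v \in [:: 120; 100; 96]).
Proof.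
split; [|split] => [[//|n] n36 T0 T1 bt|[//|n] n35 T0 T1 bt|v].
- have [n35|n6] : n.+1 \in [:: 3; 4; 5] \/ n = 5 by rewrite !inE; lia.
    by case: (small_bitrade n35 bt).
  by move: T0 T1 bt; rewrite n6 => T0 T1 /bitrade6_volume[].
- by rewrite subn1; case: (small_bitrade n35 bt).
split=> [[T0 [T1 [/bitrade6_volume[_ + <-]]]]//|].
have ne01 : (ord0 : 'I_6) != ord_max by [].
rewrite !inE => /or3P[]/eqP->.
- by apply: (@code6_bitrade (inl ord0) (inl ord_max)); rewrite ?card_codeD ?card_value_codeI.
- by apply: (@code6_bitrade (inl ord0) (inr (ord0, ord0)));
  rewrite ?card_codeD ?card_value_total_codeI.
- by apply: (@code6_bitrade (inr (ord0, ord0)) (inr (ord_max, ord_max)));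
  rewrite ?card_codeD ?card_total_codeI.
Qed.
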